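(* Let $D$ be an integral domain and $\star$ a semistar operation on $D$. Suppose that $\widetilde{\star}\text{-}\dim(D)$ is finite. Then the following statements are equivalent: (1) $D$ is a $\widetilde{\star}$-quasi-Prüfer domain. (2) For every overring $T$ of $D$ and every semistar operation $\star'$ on $T$ such that $T$ is $(\star,\star')$-linked to $D$, $T$ is a $\widetilde{\star'}$-quasi-Prüfer domain. (3) For every overring $T$ of $D$ and every semistar operation $\star'$ on $T$ such that $T$ is $(\star,\star')$-linked to $D$, $T$ is a $\widetilde{\star'}$-Jaffard domain. (4) Every overring $T$ of $D$ is a $\widetilde{\star}_{\iota}$-Jaffard domain, where $\iota$ is the canonical embedding of $D$ into $T$.
   Context: For a domain $D$ with quotient field $K$, $\overline{\mathcal F}(D)$ is the set of nonzero $D$-submodules of $K$ and $f(D)$ the set of nonzero finitely generated $D$-submodules of $K$. A semistar operation on $D$ is a map $\star:\overline{\mathcal F}(D)\to\overline{\mathcal F}(D)$, $E\mapsto E^\star$, such that for all $0\ne x\in K$ and $E,F\in\overline{\mathcal F}(D)$: $(xE)^\star=xE^\star$; $E\subseteq F$ implies $E^\star\subseteq F^\star$; $E\subseteq E^\star=(E^\star)^\star$. Define $E^{\star_f}:=\bigcup\{F^\star\mid F\in f(D),F\subseteq E\}$. A nonzero ideal $I$ of $D$ is a quasi-$\star$-ideal if $I^\star\cap D=I$; $\operatorname{QSpec}^\star(D)$ is the set of prime quasi-$\star$-ideals (quasi-$\star$-primes); $\operatorname{QMax}^{\star}(D)$ is the set of maximal elements of the set of proper quasi-$\star$-ideals (they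 are prime). $\widetilde\star$ is the semistar operation $E^{\widetilde\star}:=\bigcap\{ED_P\mid P\in\operatorname{QMax}^{\star_f}(D)\}$ (equal to $K$ if $\operatorname{QMax}^{\star_f}(D)=\emptyset$). $D$ is $\star$-quasi-Prüfer if for every prime ideal $Q$ of $D[X]$ with $Q\subseteq P[X]$ for some $P\in\operatorname{QSpec}^\star(D)$, one has $Q=(Q\cap D)[X]$. $\star\text{-}\dim(D)$ is the supremum of the integers $n$ such that there is a chain $(0)\subsetneq P_1\subsetneq\cdots\subsetneq P_n$ with each $P_i$ a quasi-$\star$-prime of $D$; it is $0$ if there are no quasi-$\star$-primes. An overring of $D$ is a ring $T$ with $D\subseteq T\subseteq K$. If $\iota:D\to T$ is the inclusion, $\star_\iota$ is the semistar operation on $T$ given by $E^{\star_\iota}:=E^\star$ for $E\in\overline{\mathcal F}(T)\subseteq\overline{\mathcal F}(D)$; $\widetilde\star_\iota$ means $(\widetilde\star)_\iota$ (it satisfies $\widetilde{\widetilde\star_\iota}=\widetilde\star_\iota$). For a semistar operation $\star'$ on $T$, $T$ is $(\star,\star')$-linked to $D$ if $F^\star=D^\star$ implies $(FT)^{\star'}=T^{\star'}$ for every nonzero finitely generated ideal $F$ of $D$. A valuation overring $V$ of $D$ ($V=K$ allowed, of dimension $0$) is a $\star$-valuation overring if $F^\star\subseteq FV$ for each $F\in f(D)$. $\star\text{-}\dim_v(D)=n$ means every $\star$-valuation overring of $D$ has dimension at most $n$ and some $\star$-valuation overring has dimension $n$; if no such integer exists, $\star\text{-}\dim_v(D)=\infty$.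 For a semistar operation $*$ with $*=\widetilde *$, a domain $D$ is a $*$-Jaffard domain if $*\text{-}\dim(D)<\infty$ and $*\text{-}\dim(D)=*\text{-}\dim_v(D)$. *)

(* Defs.v *)
From HB Require Import structures.
From mathcomp Require Import all_boot all_order all_algebra.
From mathcomp Require Import boolp classical_sets constructive_ereal.

Set Implicit Arguments.
Unset Strict Implicit.
Unset Printing Implicit Defensive.

Import Order.TTheory GRing.Theory Num.Theory.
Local Open Scope classical_set_scope.
Local Open Scope ring_scope.

(* A domain [D] is given as a subring of an ambient field [K], its quotient   *)
(* field (predicate [has_quotient_field]).  The overrings of [D] are then     *)
(* subrings of the same [K] with the same quotient field, and [D[X]] is a     *)
(* subring of [{poly K}], so every notion is stated for subsets of [K] and    *)
(* applies to [D] and to its overrings alike.                                 *)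

Section Ideals.
Variable R : comNzRingType.
Implicit Types A E I P : set R.

Definition subring A : Prop := subring_closed (mem A).

Definition submodule A E : Prop :=
  [/\ E 0, (forall x y, E x -> E y -> E (x + y))
    & (forall a x, A a -> E x -> E (a * x))].

Definition ideal A I : Prop := submodule A I /\ I `<=` A.

Definition prime_ideal A P : Prop :=
  [/\ ideal A P, P <> A
    & forall a b, A a -> A b -> P (a * b) -> P a \/ P b].

(* chain [P 0 < P 1 < ... < P n]; the values of [P] beyond [n] are irrelevant *)
Definition strict_chain (P : nat -> set R) (n : nat) : Prop :=
  forall i, (i < n)%N -> P i `<` P i.+1.

(* Never an empty supremum when [A] is a domain: [(0)] is a chain of length 0. *)
Definition krull_dim A : \bar int :=
  supremum 0%:E [set n%:Z%:E | n in [set n : nat |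
    exists P : nat -> set R,
      (forall i, (i <= n)%N -> prime_ideal A (P i)) /\ strict_chain P n]].

End Ideals.

Section Semistar.
Variable K : fieldType.
Implicit Types (D T V E F I P Q : set K) (star : set K -> set K).

Definition has_quotient_field D : Prop :=
  forall x : K, exists a b, [/\ D a, D b, b != 0 & x = a / b].

Definition nz_submodule D E : Prop := submodule D E /\ E <> [set 0].

Definition nz_ideal D I : Prop := ideal D I /\ I <> [set 0].

Definition span D (s : seq K) : set K :=
  [set x | exists c : nat -> K,
     (forall i, D (c i)) /\ x = \sum_(i < size s) c i * s`_i].

Definition fg_submodule D F : Prop :=
  nz_submodule D F /\ exists s : seq K, F = span D s.

(* [E F]: the finite sums of products *)
Definition mulset E F : set K :=
  [set x | exists s : seq (K * K),
     (forall p, p \in s -> E p.1 /\ F p.2) /\ x = \sum_(p <- s) p.1 * p.2].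

Definition localization D P : set K :=
  [set x | exists a s, [/\ D a, D s, ~ P s & x = a / s]].

(* A semistar operation is represented by a total map on subsets of [K]; its  *)
(* values outside the nonzero [D]-submodules are unconstrained, and never     *)
(* used in the definitions below.                                             *)
Definition semistar D star : Prop :=
  [/\ forall E, nz_submodule D E -> nz_submodule D (star E),
      forall x E, x != 0 -> nz_submodule D E ->
        star [set x * e | e in E] = [set x * e | e in star E],
      forall E F, nz_submodule D E -> nz_submodule D F ->
        E `<=` F -> star E `<=` star F
    & forall E, nz_submodule D E -> E `<=` star E /\ star (star E) = star E].

Definition star_f D star : set K -> set K := fun E =>
  \bigcup_(F in [set F | fg_submodule D F /\ F `<=` E]) star F.

Definition quasi_star_ideal D star I : Prop :=
  nz_ideal D I /\ star I `&` D = I.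

Definition QSpec D star : set (set K) :=
  [set P | prime_ideal D P /\ quasi_star_ideal D star P].

Definition QMax D star : set (set K) :=
  [set M | [/\ quasi_star_ideal D star M, M <> D
    & forall I, quasi_star_ideal D star I -> I <> D -> M `<=` I -> I = M]].

(* the intersection of the empty family is [K] *)
Definition star_tilde D star : set K -> set K := fun E =>
  \bigcap_(P in QMax D (star_f D star)) mulset E (localization D P).

(* [E^{star_iota} = E^star], for [E] a nonzero submodule over an overring: on *)
(* total maps, restricting to these [E] leaves the map unchanged.             *)
Definition star_iota star : set K -> set K := fun E => star E.

(* [E[X]] *)
Definition polyset E : set {poly K} := [set p | p \is a polyOver (mem E)].

Definition quasi_prufer D star : Prop :=
  forall Q : set {poly K}, prime_ideal (polyset D) Q ->
    (exists2 P, QSpec D star P & Q `<=` polyset P) ->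
    Q = polyset [set a | D a /\ Q a%:P].

(* The chain reduced to [(0)] has length 0, whence dimension 0 if there are   *)
(* no quasi-star-primes.                                                      *)
Definition star_dim D star : \bar int :=
  supremum 0%:E [set n%:Z%:E | n in [set n : nat |
    exists P : nat -> set K,
      [/\ P 0%N = [set 0], (forall i, (0 < i <= n)%N -> QSpec D star (P i))
        & strict_chain P n]]].

Definition overring D T : Prop := subring T /\ D `<=` T.

Definition linked D star T star' : Prop :=
  forall F, fg_submodule D F -> F `<=` D -> star F = star D ->
    star' (mulset F T) = star' T.

Definition valuation_overring D V : Prop :=
  overring D V /\ forall x, x != 0 -> V x \/ V x^-1.

Definition star_valuation_overring D star V : Prop :=
  valuation_overring D V /\
  forall F, fg_submodule D F -> star F `<=` mulset F V.

Definition star_dim_v D star : \bar int :=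
  xget +oo%E [set n%:Z%:E | n in [set n : nat |
    (forall V, star_valuation_overring D star V ->
       (krull_dim V <= n%:Z%:E)%E) /\
    (exists2 V, star_valuation_overring D star V & krull_dim V = n%:Z%:E)]].

(* Meant for [star = star_tilde D star]. *)
Definition jaffard D star : Prop :=
  (star_dim D star < +oo)%E /\ star_dim D star = star_dim_v D star.

End Semistar.

(* Main.v *)
Require Import Defs.
From mathcomp Require Import all_boot all_order all_algebra.
From mathcomp Require Import boolp classical_sets constructive_ereal.
From mathcomp Require Import ring.
Import Defs.

Set Implicit Arguments.
Unset Strict Implicit.
Unset Printing Implicit Defensive.

Import Order.TTheory GRing.Theory Num.Theory.
Local Open Scope classical_set_scope.
Local Open Scope ring_scope.

(* Everything is local at the maximal quasi-star_f-ideals [M] of [D]: the     *)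
(* quasi-primes of the tilde operation are the nonzero primes inside some     *)
(* [M], and its valuation overrings are [K] and those containing some [D_M].  *)
(* Quasi-Pruferness amounts to: every [t] in [K] is a root of a polynomial    *)
(* over [D] with some coefficient outside [M].  This passes to linked         *)
(* overrings and implies incomparability, so chains of primes contract        *)
(* without shrinking; with the lifting of chains to valuation rings, the two  *)
(* dimensions agree.  Conversely, if [t] violates it at [M], the primes       *)
(* [M D[t] < (M, t)] of [D[t]] lift to valuation rings [W <= V]; the overring *)
(* [D_M + m_V] has the primes of [V], but its valuation overring [W] has at   *)
(* least one more, so it is not Jaffard.                                      *)

(** The hinge is [alg_at D M] for all [M] in [QMax D (star_f D star)]. [quasi_prufer_tilde]
    identifies it with (1): if some [t] violated it, the kernel of evaluation at [t] would be a
    prime inside M[X] that is not extended from [D] ([extended_alg_at]); conversely, valuation rings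
    of K(X) show that membership in a prime inside M[X] depends on the coefficients alone
    ([alg_at_extended]).

    From (1) to (2): linkedness forces each maximal quasi-ideal of [T] to contract into some [M]
    ([linked_center]), and then the polynomial that works at [M] for [D] also works for [T]
    ([alg_at_linked]). From (2) to (3): algebraicity forbids two primes P1 < P2 of a larger ring to
    have the same trace on the base ring inside [M] ([alg_at_incomparable]), so chains contract with
    their length ([star_chain_contract]). This bounds the dimension of [T] by that of [D], and the
    dimension of valuation overrings of [T] by that of [T]; the latter bound is attained because
    chains lift to valuation rings ([valuation_over_chain]). From (3) to (4): on [T] the map
    [star_tilde D star] is a semistar operation, makes [T] linked to [D] and is its own tilde
    ([tilde_semistar], [tilde_linked], [tilde_tilde]). From (4) to (1): a transcendental residue
    yields an overring that is not Jaffard ([jaffard_alg_at]). *)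

Lemma Zorn_above (U : Type) (P : set U -> Prop) (X0 : set U) : P X0 ->
  (forall F : set (set U), F !=set0 -> F `<=` P -> (forall X, F X -> X0 `<=` X) ->
     total_on F subset -> P (\bigcup_(X in F) X)) ->
  exists M, [/\ P M, X0 `<=` M & forall X, P X -> M `<=` X -> X = M].
Proof.
move=> P0 Pchain.
(* Zorn is applied to the sets whose union with [X0] satisfies [P], so that the empty chain is
   covered by [P X0]. *)
have [F FP Ftot|M [PM Mmax]] := @Zorn_bigcup U (fun X => P (X0 `|` X)).
  have [[X FX]|F0] := pselect (F !=set0); last first.
    suff -> : X0 `|` \bigcup_(X in F) X = X0 by [].
    rewrite eqEsubset; split=> [x [//|[X FX]]|x]; last by left.
    by case: F0; exists X.
  have -> : X0 `|` \bigcup_(X in F) X = \bigcup_(Y in [set X0 `|` X | X in F]) Y.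
    rewrite eqEsubset; split=> [x [X0x|[Y FY Yx]]|x [_ [Y FY <-]] [X0x|Yx]].
    - by exists (X0 `|` X); [exists X | left].
    - by exists (X0 `|` Y); [exists Y | right].
    - by left.
    - by right; exists Y.
  apply: Pchain; first by exists (X0 `|` X), X.
  - by move=> _ [Y FY <-]; apply: FP.
  - by move=> _ [Y FY <-] x; left.
  - move=> _ _ [Y FY <-] [Z FZ <-].
    by have [YZ|ZY] := Ftot _ _ FY FZ; [left|right]; apply: setUS.
exists (X0 `|` M); split=> [//|x|X PX MX]; first by left.
apply: contrapT => XM; apply: (Mmax X).
  split; first by move=> x Mx; apply: MX; right.
  by move=> XM'; apply: XM; rewrite eqEsubset; split=> // x /XM'; right.
suff -> : X0 `|` X = X by [].
by rewrite eqEsubset; split=> [x [X0x|//]|x]; [apply: MX; left | right].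
Qed.

(** * Subrings, submodules and primes *)

Section Rings.
Variable R : comNzRingType.
Implicit Types A B E I P : set R.

Lemma subringP A : subring A <->
  [/\ A 1, (forall x y, A x -> A y -> A (x - y))
    & (forall x y, A x -> A y -> A (x * y))].
Proof.
split=> [[h1 hB hM]|[h1 hB hM]].
  split; first exact: (set_mem h1).
    by move=> x y hx hy; apply: set_mem (hB _ _ (mem_set hx) (mem_set hy)).
  by move=> x y hx hy; apply: set_mem (hM _ _ (mem_set hx) (mem_set hy)).
split; first exact: (mem_set h1).
  by move=> x y hx hy; apply: mem_set (hB _ _ (set_mem hx) (set_mem hy)).
by move=> x y hx hy; apply: mem_set (hM _ _ (set_mem hx) (set_mem hy)).
Qed.

Lemma subring1 A : subring A -> A 1. Proof. by move/subringP=> []. Qed.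
Lemma subringB A x y : subring A -> A x -> A y -> A (x - y).
Proof. by move/subringP=> [_ h _]; apply: h. Qed.
Lemma subringM A x y : subring A -> A x -> A y -> A (x * y).
Proof. by move/subringP=> [_ _ h]; apply: h. Qed.
Lemma subring0 A : subring A -> A 0.
Proof. by move=> hA; rewrite -(subrr 1); apply: subringB => //; apply: subring1. Qed.
Lemma subringN A x : subring A -> A x -> A (- x).
Proof. by move=> hA hx; rewrite -sub0r; apply: subringB => //; apply: subring0. Qed.
Lemma subringD A x y : subring A -> A x -> A y -> A (x + y).
Proof. by move=> hA hx hy; rewrite -[y]opprK; apply: subringB => //; apply: subringN. Qed.

Lemma subring_submodule A B : subring B -> A `<=` B -> submodule A B.
Proof.
move=> hB AB; split; first exact: subring0.
  by move=> x y; apply: subringD.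
by move=> a x /AB; apply: subringM.
Qed.

Lemma submod0 A E : submodule A E -> E 0. Proof. by case. Qed.
Lemma submodD A E x y : submodule A E -> E x -> E y -> E (x + y).
Proof. by case=> _ h _; apply: h. Qed.
Lemma submodM A E a x : submodule A E -> A a -> E x -> E (a * x).
Proof. by case=> _ _; apply. Qed.
Lemma submodMr A E a x : submodule A E -> A a -> E x -> E (x * a).
Proof. by rewrite mulrC; apply: submodM. Qed.
Lemma submodN A E x : subring A -> submodule A E -> E x -> E (- x).
Proof.
move=> hA hE Ex; rewrite -mulN1r; apply: (submodM hE) => //.
by apply: subringN => //; apply: subring1.
Qed.
Lemma submodB A E x y : subring A -> submodule A E -> E x -> E y -> E (x - y).
Proof. by move=> hA hE Ex Ey; apply: (submodD hE) => //; apply: (submodN hA hE). Qed.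
Lemma submod_sum A E (I : Type) (r : seq I) (F : I -> R) : submodule A E ->
  (forall i, E (F i)) -> E (\sum_(i <- r) F i).
Proof.
move=> hE hF; apply: (big_ind E) => //; first exact: submod0 hE.
by move=> x y; apply: (submodD hE).
Qed.

Lemma submoduleS A B E : A `<=` B -> submodule B E -> submodule A E.
Proof. by move=> AB [h0 hD hM]; split=> // a x /AB; apply: hM. Qed.

Lemma submoduleI A E F : submodule A E -> submodule A F -> submodule A (E `&` F).
Proof.
move=> [E0 ED EM] [F0 FD FM]; split=> //.
  by move=> x y [? ?] [? ?]; split; [apply: ED|apply: FD].
by move=> a x ? [? ?]; split; [apply: EM|apply: FM].
Qed.

Lemma prime_submod A P : prime_ideal A P -> submodule A P.
Proof. by case=> -[]. Qed.
Lemma prime_sub A P : prime_ideal A P -> P `<=` A.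
Proof. by case=> -[]. Qed.

Lemma ideal_proper A I : ideal A I -> I <> A -> ~ I 1.
Proof.
move=> [hI IA] IneA I1; apply: IneA; rewrite eqEsubset; split=> // a Aa.
by rewrite -[a]mulr1; apply: (submodM hI).
Qed.

Lemma prime_proper A P : prime_ideal A P -> ~ P 1.
Proof. by case=> hI hne _; apply: ideal_proper hne. Qed.

Lemma prime_mulP A P a b : prime_ideal A P -> A a -> A b -> P (a * b) -> P a \/ P b.
Proof. by case=> _ _; apply. Qed.

Lemma prime_idealP A P : subring A -> submodule A P -> P `<=` A -> ~ P 1 ->
  (forall a b, A a -> A b -> P (a * b) -> P a \/ P b) -> prime_ideal A P.
Proof.
move=> hA hP PA P1 hM; split=> // PE; apply: P1.
by rewrite PE; apply: subring1.
Qed.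

Lemma prime_contract A B P : subring A -> A `<=` B -> prime_ideal B P ->
  prime_ideal A (P `&` A).
Proof.
move=> hA AB hP; apply: prime_idealP => //.
- apply: submoduleI; last exact: subring_submodule.
  exact: submoduleS AB (prime_submod hP).
- by case=> P1; case: (prime_proper hP).
- move=> a b Aa Ab [Pab _].
  by have [Pa|Pb] := prime_mulP hP (AB _ Aa) (AB _ Ab) Pab; [left|right].
Qed.

Lemma prime_mulNP A P s t : prime_ideal A P -> A s -> ~ P s -> A t -> ~ P t -> ~ P (s * t).
Proof. by move=> hP As Ps At Pt /(prime_mulP hP As At)[]. Qed.

Lemma polysetP E (p : {poly R}) : E 0 ->
  ((p \is a polyOver (mem E)) <-> forall i, E p`_i).
Proof.
move=> E0; split=> [/allP h i|h].
  have [ip|ip] := ltnP i (size p); first by apply: set_mem; apply: h; rewrite mem_nth.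
  by rewrite nth_default.
by apply/(all_nthP 0) => i _; apply: mem_set.
Qed.

End Rings.

Lemma polyset_coef (K : fieldType) (E : set K) (p : {poly K}) : E 0 ->
  polyset E p <-> forall i, E p`_i.
Proof. exact: polysetP. Qed.

(** * Polynomials with coefficients in a submodule *)

Section Poly.
Variable K : fieldType.
Implicit Types A B E I P : set K.

Lemma polysetC E c : E 0 -> polyset E c%:P <-> E c.
Proof.
move=> E0; rewrite polyset_coef //; split=> [/(_ 0%N)|Ec i]; first by rewrite coefC.
by rewrite coefC; case: eqP.
Qed.

Lemma polyset_sub E F : E 0 -> E `<=` F -> polyset E `<=` polyset F.
Proof. by move=> E0 EF p; rewrite !polyset_coef // => [h i|]; apply: EF. Qed.

Lemma polyset_submodule A E : subring A -> submodule A E ->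
  submodule (polyset A) (polyset E).
Proof.
move=> hA hE; have A0 := subring0 hA; have E0 := submod0 hE; split.
- exact/polysetC.
- move=> p q /(polyset_coef _ E0) hp /(polyset_coef _ E0) hq.
  by apply/polyset_coef => // i; rewrite coefD; apply: (submodD hE).
- move=> p q /(polyset_coef _ A0) hp /(polyset_coef _ E0) hq.
  apply/polyset_coef => // i; rewrite coefM; apply: (submod_sum _ hE) => j.
  exact: (submodM hE).
Qed.

Lemma polyset_subring A : subring A -> subring (polyset A).
Proof.
move=> hA; have A0 := subring0 hA.
have hm : submodule (polyset A) (polyset A).
  by apply: polyset_submodule => //; apply: subring_submodule.
apply/subringP; split.
- by apply/polysetC => //; apply: subring1.
- move=> p q hp hq; apply: (submodD hm) => //; rewrite -mulN1r.
  apply: (submodM hm) => //; rewrite -polyCN; apply/polysetC => //.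
  by apply: subringN => //; apply: subring1.
- by move=> p q; apply: (submodM hm).
Qed.

Lemma polysetX A : subring A -> polyset A 'X.
Proof.
move=> hA; apply/polyset_coef; first exact: subring0.
by move=> i; rewrite coefX; case: eqP => _; [apply: subring1|apply: subring0].
Qed.

Lemma horner_submod A E p x : submodule A E -> A x -> subring A -> polyset E p -> E p.[x].
Proof.
move=> hE Ax hA /(polyset_coef _ (submod0 hE)) hp; rewrite horner_coef.
apply: (submod_sum _ hE) => i; apply: (submodMr hE) => //.
by elim: (i : nat) => [|n IH]; rewrite ?expr0 ?exprS; [apply: subring1|apply: subringM].
Qed.

(* Gauss: look at the lowest coefficients of the two factors lying outside [P] *)
Lemma polyset_prime A P : subring A -> prime_ideal A P ->
  prime_ideal (polyset A) (polyset P).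
Proof.
move=> hA hP; have hPm := prime_submod hP; have P0 := submod0 hPm.
have A0 := subring0 hA; have PA := prime_sub hP.
have hpP := polyset_submodule hA hPm; have hpA := polyset_subring hA.
apply: prime_idealP => //.
- exact: polyset_sub.
- by move=> /(polysetC _ P0); apply: prime_proper hP.
have lowest (p : {poly K}) : ~ polyset P p ->
    exists2 i, ~ P p`_i & forall j, (j < i)%N -> P p`_j.
  move=> /(polyset_coef _ P0) /existsNP hi.
  have hi' : exists i, `[< ~ P p`_i >] by case: hi => i; exists i; apply/asboolP.
  exists (ex_minn hi'); case: ex_minnP => i /asboolP ni hmin //.
  by move=> j; rewrite ltnNge => ji; apply: contrapT => nj; case/negP: ji; apply/hmin/asboolP.
move=> p q /(polyset_coef _ A0) Ap /(polyset_coef _ A0) Aq Ppq.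
apply: contrapT => /not_orP[/lowest[i pi ip] /lowest[j qj jq]].
suff : P (p`_i * q`_j) by move=> /(prime_mulP hP (Ap i) (Aq j))[].
have lt : (i < (i + j).+1)%N by rewrite ltnS leq_addr.
(* In the coefficient of degree [i + j], every term other than the product of the two chosen
   coefficients has a factor of index below [i] or below [j], hence lies in [P]. *)
have := (polyset_coef _ P0).1 Ppq (i + j)%N.
rewrite coefM (bigD1 (Ordinal lt)) //= addKn => Psum.
rewrite -[X in P X](addrK (\sum_(k < (i + j).+1 | k != Ordinal lt) p`_k * q`_(i + j - k))).
apply: (submodB hA hPm) => //; apply: (big_ind P) => //.
  by move=> x y; apply: (submodD hPm).
move=> k; rewrite -val_eqE /= neq_ltn => /orP[ki|ik].
  by apply: (submodMr hPm) => //; apply: ip.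
apply: (submodM hPm) => //; apply: jq.
by have := ltn_ord k; rewrite ltnS => kij; rewrite ltn_subLR // ltn_add2r.
Qed.

End Poly.

(** * Valuation rings *)

Section Valuations.
Variable L : fieldType.
Implicit Types A B C E J N P Q V W : set L.

Definition valuation_ring V : Prop :=
  subring V /\ forall x, x != 0 -> V x \/ V x^-1.

(** The nonunits of [V]. Zero is listed apart because its formal inverse is 0, which lies in [V]. *)
Definition max_ideal V : set L := [set x | x = 0 \/ ~ V x^-1].

Lemma max_ideal_sub V : valuation_ring V -> max_ideal V `<=` V.
Proof.
move=> [hV val] x [->|Vx]; first exact: subring0.
have [->|/val[//|//]] := eqVneq x 0; exact: subring0.
Qed.

(** One of [x / y] and its inverse lies in [V], so [x + y] is a [V]-multiple of [x] or of [y]. If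
    [a] is a unit of [V], then [b] is a [V]-multiple of [a * b], whence primality. *)
Lemma max_ideal_prime V : valuation_ring V -> prime_ideal V (max_ideal V).
Proof.
move=> hv; have [hV val] := hv; have mV := max_ideal_sub hv.
have mM a x : V a -> max_ideal V x -> max_ideal V (a * x).
  move=> Va [->|Vx]; first by left; rewrite mulr0.
  have [->|a0] := eqVneq a 0; first by left; rewrite mul0r.
  right=> Vax; apply: Vx; have := subringM hV Va Vax.
  by rewrite invfM mulrA divff // mul1r.
have m1 : ~ max_ideal V 1.
  by case=> [/eqP|]; rewrite ?oner_eq0 // invr1 => /(_ (subring1 hV)).
apply: prime_idealP => //.
  split; [by left| |by move=> a x; apply: mM].
  move=> x y mx my; have [->|x0] := eqVneq x 0; first by rewrite add0r.
  have [->|y0] := eqVneq y 0; first by rewrite addr0.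
  have [|Vxy|Vyx] := val (x / y); first by rewrite mulf_neq0 ?invr_eq0.
    have -> : x + y = (x / y + 1) * y by field.
    by apply: mM => //; apply: subringD => //; apply: subring1.
  have -> : x + y = ((x / y)^-1 + 1) * x by field; rewrite x0 y0.
  by apply: mM => //; apply: subringD => //; apply: subring1.
move=> a b Va Vb mab; apply: contrapT => /not_orP[ma mb]; apply: m1.
have [a0 /contrapT Va'] : a <> 0 /\ ~ ~ V a^-1 by apply/not_orP.
rewrite -(mulVf (introN eqP a0)) -[X in X^-1 * _]mulr1.
case: mb; rewrite -[b](mulKf (introN eqP a0)); exact: mM.
Qed.

Lemma prime_sub_max_ideal V P : valuation_ring V -> prime_ideal V P -> P `<=` max_ideal V.
Proof.
move=> [hV _] hP x Px; have [->|x0] := eqVneq x 0; [by left|right=> Vx].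
apply: (prime_proper hP); rewrite -(mulVf x0).
by apply: (submodM (prime_submod hP)).
Qed.

(** The extension of [N] to [B], as an intersection: a membership is exploited by exhibiting one
    suitable submodule. *)
Definition generated B N : set L :=
  [set x | forall J, submodule B J -> N `<=` J -> J x].

Lemma generated_submodule B N : submodule B (generated B N).
Proof.
split=> [J hJ _|x y hx hy J hJ NJ|a x Ba hx J hJ NJ]; first exact: submod0 hJ.
  by apply: (submodD hJ); [apply: hx|apply: hy].
by apply: (submodM hJ) => //; apply: hx.
Qed.

Lemma sub_generated B N : N `<=` generated B N.
Proof. by move=> x Nx J _; apply. Qed.

Lemma generatedS B C N : B `<=` C -> generated B N `<=` generated C N.
Proof. by move=> BC x hx J hJ; apply: hx; apply: submoduleS hJ. Qed.

(** * Valuation rings with a prescribed centre *)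

Section Existence.
Variables (A N : set L).
Hypotheses (hA : subring A) (hN : prime_ideal A N).

(** The prime [N] need not be maximal in [A], so the extension of [N] to [B] is required to avoid
    every element of [A] outside [N], and not only 1. *)
Let P B := [/\ subring B, A `<=` B & forall s, A s -> ~ N s -> ~ generated B N s].

Let chainP (F : set (set L)) : F !=set0 -> F `<=` P ->
  (forall X, F X -> A `<=` X) -> total_on F subset -> P (\bigcup_(X in F) X).
Proof.
move=> [X0 FX0] FP FA Ftot.
have dir X Y : F X -> F Y -> exists Z, [/\ F Z, X `<=` Z & Y `<=` Z].
  by move=> FX FY; have [XY|YX] := Ftot _ _ FX FY; [exists Y|exists X]; split=> // ?.
split.
- apply/subringP; split.
  + by exists X0 => //; have [/subring1] := FP _ FX0.
  + move=> x y [X FX Xx] [Y FY Yy]; have [Z [FZ XZ YZ]] := dir _ _ FX FY.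
    exists Z => //; have [hZ _ _] := FP _ FZ.
    by apply: (subringB hZ); [apply: XZ|apply: YZ].
  + move=> x y [X FX Xx] [Y FY Yy]; have [Z [FZ XZ YZ]] := dir _ _ FX FY.
    exists Z => //; have [hZ _ _] := FP _ FZ.
    by apply: (subringM hZ); [apply: XZ|apply: YZ].
- by move=> x Ax; exists X0 => //; apply: FA.
(* Along a chain, the union of the extensions of [N] to the members is a submodule over the union of
   the members, so it contains the extension of [N] to that union. *)
- move=> s As Ns /(_ (\bigcup_(X in F) generated X N))[].
  + split; first by exists X0 => //; apply: submod0 (generated_submodule _ _).
      move=> x y [X FX Xx] [Y FY Yy]; have [Z [FZ XZ YZ]] := dir _ _ FX FY.
      by exists Z => //; apply: (submodD (generated_submodule _ _)); [apply: generatedS XZ _ _|apply: generatedS YZ _ _].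
    move=> x y [X FX Xx] [Y FY Yy]; have [Z [FZ XZ YZ]] := dir _ _ FX FY.
    by exists Z => //; apply: (submodM (generated_submodule _ _)); [apply: XZ|apply: generatedS YZ _ _].
  + by move=> x Nx; exists X0 => //; apply: sub_generated.
  + by move=> X FX; have [_ _ h] := FP _ FX; apply: h.
Qed.

Section Maximal.
Variable B : set L.
Hypotheses (PB : P B) (Bmax : forall X, P X -> B `<=` X -> X = B).

Let J := generated B N.
Let hB : subring B. Proof. by have [] := PB. Qed.
Let AB : A `<=` B. Proof. by have [] := PB. Qed.
Let hJ : submodule B J. Proof. exact: generated_submodule. Qed.
Let JB : J `<=` B.
Proof.
move=> x; apply; first exact: subring_submodule.
by move=> y /(prime_sub hN)/AB.
Qed.
Let JA s : A s -> ~ N s -> ~ J s.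
Proof. by have [_ _ h] := PB; apply: h. Qed.

(** A multiplicative set containing [A] minus [N] and, modulo sign, all [1 + j] with [j] in [J]. It
    avoids [J], and the maximality of [B] turns its elements into units. *)
Let S : set L := [set u | B u /\ exists s, [/\ A s, ~ N s & J (u - s)]].

Let S_NJ u s : S u -> A s -> ~ N s -> ~ J (s * u).
Proof.
move=> [Bu [t [At Nt Jut]]] As Ns Jsu.
apply: (@JA (s * t)); first exact: subringM.
  exact: prime_mulNP Ns At Nt.
have -> : s * t = s * u - s * (u - t) by ring.
by apply: (submodB hB hJ) => //; apply: (submodM hJ) => //; apply: AB.
Qed.

Let SM u v : S u -> S v -> S (u * v).
Proof.
move=> [Bu [s [As Ns Jus]]] [Bv [t [At Nt Jvt]]]; split; first exact: subringM.
exists (s * t); split; [exact: subringM|exact: prime_mulNP Ns At Nt|].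
have -> : u * v - s * t = u * (v - t) + t * (u - s) by ring.
by apply: (submodD hJ); apply: (submodM hJ) => //; apply: AB.
Qed.

Let S1 : S 1.
Proof.
split; first exact: subring1.
exists 1; split; [exact: subring1|exact: prime_proper hN|].
by rewrite subrr; apply: submod0 hJ.
Qed.

Let Sn0 u : S u -> u != 0.
Proof.
move=> Su; apply/eqP => u0; apply: (S_NJ Su (subring1 hA) (prime_proper hN)).
by rewrite u0 mulr0; apply: submod0 hJ.
Qed.

(** The fractions over [B] with denominators in [S] again satisfy [P], by [S_NJ]; by maximality they
    form [B] itself. *)
Let SV u : S u -> B u^-1.
Proof.
pose C := [set x | exists b v, [/\ B b, S v & x = b / v]].
suff CB : C = B by move=> Su; rewrite -CB; exists 1, u; rewrite mul1r; split=> //; apply: subring1.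
have BC : B `<=` C by move=> b Bb; exists b, 1; rewrite divr1.
have BS v : S v -> B v by case.
apply: Bmax => //; split.
- apply/subringP; split; first exact: BC (subring1 hB).
  + move=> _ _ [b [v [Bb Sv ->]]] [c [w [Bc Sw ->]]].
    exists (b * w - c * v), (v * w); split; last by field; rewrite !Sn0.
      by apply: subringB => //; apply: subringM => //; apply: BS.
    exact: SM.
  + move=> _ _ [b [v [Bb Sv ->]]] [c [w [Bc Sw ->]]].
    exists (b * c), (v * w); split; [exact: subringM|exact: SM|].
    by field; rewrite !Sn0.
- by move=> x /AB/BC.
- move=> s As Ns /(_ [set x | exists j v, [/\ J j, S v & x = j / v]])[].
  + split; first by exists 0, 1; split=> //; [exact: submod0 hJ|rewrite mul0r].
      move=> _ _ [b [v [Jb Sv ->]]] [c [w [Jc Sw ->]]].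
      exists (w * b + v * c), (v * w); split; last by field; rewrite !Sn0.
        by apply: (submodD hJ); apply: (submodM hJ) => //; apply: BS.
      exact: SM.
    move=> _ _ [b [v [Bb Sv ->]]] [c [w [Jc Sw ->]]].
    exists (b * c), (v * w); split; [exact: (submodM hJ)|exact: SM|].
    by field; rewrite !Sn0.
  + by move=> x Nx; exists x, 1; rewrite divr1; split=> //; apply: sub_generated.
  + move=> j [v [Jj Sv sE]]; apply: (S_NJ Sv As Ns).
    by rewrite sE divfK // Sn0.
Qed.

(** By maximality B[x] violates [P]: some [s] in [A] outside [N] is the value at [x] of a polynomial
    over [J]. Since [s] is a unit of [B], it can be divided out. *)
Let adjoin_poly x : ~ B x -> exists2 p, polyset J p & p.[x] = 1.
Proof.
move=> Bx; pose C := [set p.[x] | p in polyset B].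
have hp := polyset_subring hB; have B0 := subring0 hB.
have BC : B `<=` C by move=> b Bb; exists b%:P; [apply/polysetC|rewrite hornerC].
have hC : subring C.
  apply/subringP; split; first exact: BC (subring1 hB).
    by move=> _ _ [p Bp <-] [q Bq <-]; exists (p - q); [apply: subringB|rewrite !hornerE].
  by move=> _ _ [p Bp <-] [q Bq <-]; exists (p * q); [apply: subringM|rewrite !hornerE].
have /not_and3P nPC : ~ P C.
  move=> /Bmax /(_ BC) CB; apply: Bx; rewrite -CB.
  by exists 'X; [exact: polysetX|rewrite hornerX].
have [s [As Ns gs]] : exists s, [/\ A s, ~ N s & generated C N s].
  apply: contrapT => h; case: nPC => [//|nAC|ns]; first by apply: nAC => y /AB/BC.
  by apply: ns => s As Ns gs; apply: h; exists s.
have hpJ := polyset_submodule hB hJ.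
have [p Jp pE] : [set p.[x] | p in polyset J] s.
  apply: gs.
    split; first by exists 0; [exact: submod0 hpJ|rewrite horner0].
      by move=> _ _ [p Bp <-] [q Bq <-]; exists (p + q); [apply: (submodD hpJ)|rewrite !hornerE].
    by move=> _ _ [p Bp <-] [q Bq <-]; exists (p * q); [apply: (submodM hpJ)|rewrite !hornerE].
  move=> y Ny; exists y%:P; last by rewrite hornerC.
  by apply/polysetC; [exact: submod0 hJ|exact: sub_generated].
have Ss : S s.
  by split; [exact: AB|exists s; rewrite subrr; split=> //; exact: submod0 hJ].
exists (s^-1%:P * p); last by rewrite !hornerE pE mulVf // Sn0.
by apply: (submodM hpJ) => //; apply/polysetC => //; exact: SV.
Qed.

(* If [x] and [1/x] were both roots of equations [p = 1], [q = 1] over [J],  *)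
(* the one of smaller degree would lower the degree of the other.            *)
Let no_two_polys n x (p q : {poly L}) : (size p + size q < n)%N -> x != 0 ->
  polyset J p -> polyset J q -> p.[x] = 1 -> q.[x^-1] = 1 -> False.
Proof.
elim: n x p q => // n IH x p q; wlog le_qp : x p q / (size q <= size p)%N.
  move=> wl hn x0 Jp Jq px qx; have [qp|pq] := leqP (size q) (size p).
    exact: (wl x p q).
  by apply: (wl x^-1 q p); rewrite ?invrK ?invr_eq0 // 1?addnC // ltnW.
rewrite ltnS => hn x0 Jp Jq px qx.
have J0 := submod0 hJ.
have {}Jp := (polyset_coef _ J0).1 Jp; have Jq' := (polyset_coef _ J0).1 Jq.
have [m sp] : exists m, size p = m.+1.
  case E: (size p) => [|m]; last by exists m.
  move/eqP: E px; rewrite size_poly_eq0 => /eqP ->.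
  by rewrite horner0 => /eqP; rewrite eq_sym oner_eq0.
(* The element 1 - q_0 lies in [S], being congruent to 1 modulo [J]; hence [c] belongs to [B]. *)
pose c := (1 - q`_0)^-1.
have Sq : S (1 - q`_0).
  split; first by apply: subringB => //; [exact: subring1|exact: JB].
  exists 1; split; [exact: subring1|exact: prime_proper hN|].
  by rewrite addrAC subrr add0r; apply: (submodN hB hJ).
have Bc : B c by apply: SV.
(* Multiplying q(1/x) = 1 by x^m expresses x^m through lower powers of [x] (recall that [q] has
   degree at most [m]); [r] is [p] with its leading power x^m so replaced. *)
pose r := \poly_(i < m) (p`_i + c * p`_m * q`_(m - i)).
have sr : (size r <= m)%N by exact: size_poly.
apply: (IH x r q) => //.
- by apply: leq_trans hn; rewrite sp addSn ltnS leq_add2r.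
- apply/polyset_coef => // i; rewrite coef_poly; case: ifP => // _.
  apply: (submodD hJ) => //; apply: (submodM hJ) => //.
  by apply: subringM => //; apply: JB.
have qE : \sum_(i < m) q`_(m - i) * x ^+ i + q`_0 * x ^+ m = x ^+ m.
  have := qx; rewrite (@horner_coef_wide _ m.+1); last by rewrite -sp.
  rewrite (reindex_inj rev_ord_inj) /= => qx'.
  rewrite -[RHS]mulr1 -[in RHS]qx' big_ord_recr /= subnn mulrDr expr0 mulr1.
  rewrite [X in _ = _ + X]mulrC; congr (_ + _); rewrite mulr_sumr; apply: eq_bigr => i _.
  rewrite subSS mulrCA; congr (_ * _); rewrite exprVn.
  have im : (i <= m)%N by apply: ltnW.
  by rewrite -{2}(subnKC im) exprD mulfK // expf_neq0.
rewrite /r horner_poly.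
have -> : \sum_(i < m) (p`_i + c * p`_m * q`_(m - i)) * x ^+ i =
    \sum_(i < m) p`_i * x ^+ i + c * p`_m * \sum_(i < m) q`_(m - i) * x ^+ i.
  by rewrite mulr_sumr -big_split; apply: eq_bigr => i _ /=; ring.
rewrite -[RHS]px (horner_coef p) sp big_ord_recr /=.
congr (_ + _).
have -> : \sum_(i < m) q`_(m - i) * x ^+ i = (1 - q`_0) * x ^+ m.
  by rewrite mulrBl mul1r -{1}qE addrK.
by rewrite /c; have := Sn0 Sq => h; field.
Qed.

(** If [x] and its inverse both lay outside [B], [adjoin_poly] would give the two equations excluded
    by [no_two_polys]. As for the trace on [A]: elements outside [N] are in [S], hence units, while
    those of [N] lie in [J], which does not contain 1. *)
Lemma maximal_valuation : valuation_ring B /\ max_ideal B `&` A = N.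
Proof.
split.
  split=> // x x0; apply: contrapT => /not_orP[Bx Bx'].
  have [p Jp px] := adjoin_poly Bx; have [q Jq qx] := adjoin_poly Bx'.
  exact: (no_two_polys (ltnSn _) x0 Jp Jq).
rewrite eqEsubset; split=> x.
  case=> mx Ax; apply: contrapT => Nx.
  have Sx : S x.
    by split; [exact: AB|exists x; rewrite subrr; split=> //; exact: submod0 hJ].
  by case: mx => [x0|]; [move: (Sn0 Sx); rewrite x0 eqxx|apply; exact: SV].
move=> Nx; split; last exact: prime_sub Nx.
have [->|x0] := eqVneq x 0; [by left|right=> Bx].
apply: (JA (subring1 hA) (prime_proper hN)); rewrite -(mulVf x0).
by apply: (submodM hJ) => //; apply: sub_generated.
Qed.

End Maximal.

(** Chevalley's extension theorem, from a maximal member of [P] above [A]. *)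
Lemma valuation_exists :
  exists V, [/\ valuation_ring V, A `<=` V & max_ideal V `&` A = N].
Proof.
have PA : P A.
  split=> // s As Ns /(_ N (prime_submod hN)) h; exact/Ns/h.
have [B [PB AB Bmax]] := Zorn_above PA chainP.
by have [] := maximal_valuation PB Bmax; exists B.
Qed.

End Existence.

(** Composition of valuations. Since the trace [Q] of [max_ideal V] lies in [N], the set N + m_V is
    a prime of A + m_V. A valuation ring [W] centred on it has m_V inside m_W, and taking inverses
    gives the inclusion of [W] in [V]. *)
Lemma valuation_refine A Q N V : subring A -> prime_ideal A N -> Q `<=` N ->
  valuation_ring V -> A `<=` V -> max_ideal V `&` A = Q ->
  exists W, [/\ valuation_ring W, A `<=` W, W `<=` V,
    max_ideal V `<=` max_ideal W & max_ideal W `&` A = N].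
Proof.
move=> hA hN QN hv AV mVA; have [hV val] := hv.
have mm := prime_submod (max_ideal_prime hv); have mV := max_ideal_sub hv.
have hNm := prime_submod hN; have NA := prime_sub hN.
have mAN a : A a -> max_ideal V a -> N a by move=> Aa ma; apply: QN; rewrite -mVA.
pose A1 := [set x | exists a m, [/\ A a, max_ideal V m & x = a + m]].
pose N1 := [set x | exists a m, [/\ N a, max_ideal V m & x = a + m]].
have m0 : max_ideal V 0 by left.
have hA1 : subring A1.
  apply/subringP; split; first by exists 1, 0; rewrite addr0; split=> //; exact: subring1.
    move=> _ _ [a [m [Aa mm1 ->]]] [b [n [Ab mn ->]]]; exists (a - b), (m - n).
    by split; [exact: subringB|exact: (submodB hV mm)|ring].
  move=> _ _ [a [m [Aa mm1 ->]]] [b [n [Ab mn ->]]].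
  exists (a * b), (a * n + (b + n) * m); split; [exact: subringM| |ring].
  apply: (submodD mm); apply: (submodM mm) => //; first exact: AV.
  by apply: subringD => //; [exact: AV|exact: mV].
have hN1 : prime_ideal A1 N1.
  apply: prime_idealP => //.
  - split; first by exists 0, 0; rewrite addr0; split=> //; exact: submod0 hNm.
      move=> _ _ [a [m [Na mm1 ->]]] [b [n [Nb mn ->]]]; exists (a + b), (m + n).
      by split; [exact: (submodD hNm)|exact: (submodD mm)|ring].
    move=> _ _ [a [m [Aa mm1 ->]]] [b [n [Nb mn ->]]].
    exists (a * b), (a * n + (b + n) * m); split; [exact: (submodM hNm)| |ring].
    apply: (submodD mm); apply: (submodM mm) => //; first exact: AV.
    by apply: subringD => //; [exact/AV/NA|exact: mV].
  - by move=> _ [a [m [Na mm1 ->]]]; exists a, m; split=> //; exact: NA.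
  - move=> [a [m [Na mm1 E]]]; apply: (prime_proper hN).
    have mE : m = 1 - a by rewrite E addrC addKr.
    rewrite -(subrK a 1); apply: (submodD hNm) => //; apply: mAN; last by rewrite -mE.
    by apply: subringB => //; [exact: subring1|exact: NA].
  - move=> _ _ [a [m [Aa mm1 ->]]] [b [n [Ab mn ->]]] [c [k [Nc mk E]]].
    have Nab : N (a * b).
      rewrite -(subrK c (a * b)); apply: (submodD hNm) => //; apply: mAN.
        by apply: subringB => //; [exact: subringM|exact: NA].
      have -> : a * b - c = k - (a * n + (b + n) * m).
        by apply/eqP; rewrite subr_eq addrAC -subr_eq opprK addrC -E; apply/eqP; ring.
      apply: (submodB hV mm) => //; apply: (submodD mm); apply: (submodM mm) => //.
        exact: AV.
      by apply: subringD => //; [exact: AV|exact: mV].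
    by have [Na|Nb] := prime_mulP hN Aa Ab Nab; [left; exists a, m|right; exists b, n].
have [W [hw A1W mW]] := valuation_exists hA1 hN1.
have mVW : max_ideal V `<=` max_ideal W.
  move=> x mx; suff [] : (max_ideal W `&` A1) x by [].
  by rewrite mW; exists 0, x; rewrite add0r; split=> //; exact: submod0 hNm.
exists W; split=> //.
- by move=> a Aa; apply: A1W; exists a, 0; rewrite addr0.
- move=> x Wx; apply: contrapT => Vx.
  have [x0|x0] := eqVneq x 0; first by apply: Vx; rewrite x0; exact: subring0.
  have [|x'0|] := mVW x^-1; first by right; rewrite invrK.
    by move: x0; rewrite -invr_eq0 x'0 eqxx.
  by rewrite invrK.
- rewrite eqEsubset; split=> x.
    move=> [mx Ax].
    have [a [m [Na mm1 E]]] : N1 x by rewrite -mW; split=> //; exists x, 0; rewrite addr0.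
    rewrite E; apply: (submodD hNm) => //; apply: mAN => //.
    have -> : m = x - a by rewrite E addrC addKr.
    by apply: subringB => //; exact: NA.
  move=> Nx; split; last exact: NA.
  by suff [] : (max_ideal W `&` A1) x by []; rewrite mW; exists x, 0; rewrite addr0.
Qed.

Lemma prime_refine V W P : valuation_ring V -> valuation_ring W -> W `<=` V ->
  max_ideal V `<=` max_ideal W -> prime_ideal V P -> prime_ideal W P.
Proof.
move=> hV hW WV mVW hP.
have PW : P `<=` W.
  by move=> x /(prime_sub_max_ideal hV hP)/mVW/(max_ideal_sub hW).
have <- : P `&` W = P by rewrite eqEsubset; split=> [x []//|x Px]; split=> //; exact: PW.
by apply: prime_contract hP => //; case: hW.
Qed.

End Valuations.

(** * Algebraicity modulo a prime *)

Section Image.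
Variables (R S : comNzRingType) (f : {rmorphism R -> S}).
Implicit Types (A P : set R) (B Q : set S).

Lemma subring_image A : subring A -> subring (f @` A).
Proof.
move=> hA; apply/subringP; split; first by exists 1; [exact: subring1|rewrite rmorph1].
  by move=> _ _ [x Ax <-] [y Ay <-]; exists (x - y); [exact: subringB|rewrite rmorphB].
by move=> _ _ [x Ax <-] [y Ay <-]; exists (x * y); [exact: subringM|rewrite rmorphM].
Qed.

Lemma prime_image A P : injective f -> subring A -> prime_ideal A P ->
  prime_ideal (f @` A) (f @` P).
Proof.
move=> inj_f hA hP; have hPm := prime_submod hP.
apply: prime_idealP; first exact: subring_image.
- split; first by exists 0; [exact: submod0 hPm|rewrite rmorph0].
    by move=> _ _ [x Px <-] [y Py <-]; exists (x + y); [exact: (submodD hPm)|rewrite rmorphD].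
  by move=> _ _ [x Ax <-] [y Py <-]; exists (x * y); [exact: (submodM hPm)|rewrite rmorphM].
- by move=> _ [x /(prime_sub hP) Ax <-]; exists x.
- move=> [x Px]; rewrite -(rmorph1 f) => /inj_f x1.
  by apply: (prime_proper hP); rewrite -x1.
- move=> _ _ [x Ax <-] [y Ay <-] [z Pz]; rewrite -rmorphM => /inj_f zE.
  by move: Pz; rewrite zE => /(prime_mulP hP Ax Ay)[Px|Py]; [left; exists x|right; exists y].
Qed.

Lemma subring_preimage B : subring B -> subring (f @^-1` B).
Proof.
move=> hB; apply/subringP; split; rewrite /preimage /=.
- by rewrite rmorph1; apply: subring1.
- by move=> x y Bx By; rewrite rmorphB; apply: subringB.
- by move=> x y Bx By; rewrite rmorphM; apply: subringM.
Qed.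

Lemma prime_preimage B Q : subring B -> prime_ideal B Q ->
  prime_ideal (f @^-1` B) (f @^-1` Q).
Proof.
move=> hB hQ; have hQm := prime_submod hQ.
apply: prime_idealP; first exact: subring_preimage.
- split; rewrite /preimage /=; first by rewrite rmorph0; apply: submod0 hQm.
    by move=> x y Qx Qy; rewrite rmorphD; apply: (submodD hQm).
  by move=> x y Bx Qy; rewrite rmorphM; apply: (submodM hQm).
- by move=> x /(prime_sub hQ).
- by rewrite /preimage /= rmorph1; apply: prime_proper hQ.
- by move=> x y; rewrite /preimage /= rmorphM; apply: prime_mulP hQ.
Qed.

End Image.

Section AlgebraicAt.
Variable K : fieldType.
Implicit Types (A B D T M N P V : set K).

(* When [M] is prime: the residue fields of the primes lying over [M] in the *)
(* overrings of [A] are algebraic over that of [M].                          *)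
Definition alg_at A M : Prop := forall t : K,
  exists f, [/\ polyset A f, ~ polyset M f & f.[t] = 0].

Lemma alg_atS A B M N : A 0 -> M 0 -> N 0 -> A `<=` B -> N `&` A `<=` M ->
  alg_at A M -> alg_at B N.
Proof.
move=> A0 M0 N0 AB NM alg t; have [f [Af Mf ft]] := alg t; exists f; split=> //.
  exact: polyset_sub Af.
move=> Nf; apply: Mf; apply/polyset_coef => // i; apply: NM.
by split; [move/polyset_coef: Nf; apply|move/polyset_coef: Af; apply].
Qed.

(** Induction by Horner's scheme: if f(x) x + c lies in [P1], then [c] lies in [P2] because [x]
    does, hence in [P1] by hypothesis; so f(x) x is in [P1], and f(x) too since [x] is not. The
    morphism [phi] covers both overrings inside [K] and valuation rings of K(X). *)
Lemma coefs_in_prime (L : fieldType) (phi : {rmorphism K -> L}) (A : set K)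
    (B P1 P2 : set L) (x : L) : subring A -> subring B ->
  prime_ideal B P1 -> prime_ideal B P2 -> P1 `<=` P2 -> P2 x -> ~ P1 x ->
  (forall a, A a -> B (phi a)) -> (forall a, A a -> P2 (phi a) -> P1 (phi a)) ->
  forall f, polyset A f -> P1 (map_poly phi f).[x] -> forall i, P1 (phi f`_i).
Proof.
move=> hA hB hP1 hP2 P12 P2x P1x AB P21 f.
have A0 := subring0 hA; have h1 := prime_submod hP1; have h2 := prime_submod hP2.
elim/poly_ind: f => [_ _ i|f c IH /(polyset_coef _ A0) Afc].
  by rewrite coef0 rmorph0; apply: submod0 h1.
have Af : polyset A f.
  apply/polyset_coef => // i; have := Afc i.+1.
  by rewrite coefD coefMX coefC /= addr0.
have Ac : A c by have := Afc 0%N; rewrite coefD coefMX coefC /= add0r.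
rewrite rmorphD rmorphM /= map_polyX map_polyC !hornerE => P1fc.
have Bf : B (map_poly phi f).[x].
  apply: (@horner_submod _ B) => //; first exact: subring_submodule.
    exact: (prime_sub hP2).
  apply/polyset_coef; first exact: subring0.
  by move=> i; rewrite coef_map; apply: AB; move/polyset_coef: Af; apply.
have P1c : P1 (phi c).
  apply: P21 => //; rewrite -[phi c](addKr ((map_poly phi f).[x] * x)).
  rewrite addrC; apply: (submodB hB h2); first exact: P12.
  exact: (submodM h2).
have P1f : P1 (map_poly phi f).[x].
  have : P1 ((map_poly phi f).[x] * x).
    by rewrite -[_ * x](addrK (phi c)); apply: (submodB hB h1).
  by move/(prime_mulP hP1 Bf (prime_sub hP2 P2x)) => [].
case=> [|i]; rewrite coefD coefMX coefC /= ?add0r // addr0; exact: IH.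
Qed.

(** For [t] in [P2] outside [P1], a polynomial [f] killing [t] has value 0 in [P1], so
    [coefs_in_prime] puts all its coefficients in [P1], hence in [M], against the choice of [f]. *)
Lemma alg_at_incomparable A B M P1 P2 : subring A -> subring B -> A `<=` B -> M 0 ->
  alg_at A M -> prime_ideal B P1 -> prime_ideal B P2 -> P1 `<=` P2 ->
  P1 `&` A `<=` M -> P2 `&` A `<=` P1 -> P2 `<=` P1.
Proof.
move=> hA hB AB M0 alg hP1 hP2 P12 P1M P21 t P2t; apply: contrapT => P1t.
have [f [Af Mf ft]] := alg t; apply: Mf; apply/polyset_coef => // i; apply: P1M.
split; last by move/(polyset_coef _ (subring0 hA)): Af; apply.
apply: (coefs_in_prime (phi := idfun) hA hB hP1 hP2 P12 P2t P1t) => //.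
  by move=> a Aa P2a; apply: P21.
by rewrite map_poly_id // ft; apply: submod0 (prime_submod hP1).
Qed.

(** Divisibility in a valuation ring is total, so one of the finitely many coefficients divides all
    the others. *)
Lemma valuation_max_coef V (p : {poly K}) : valuation_ring V -> p != 0 ->
  exists2 j, p`_j != 0 & forall i, V (p`_i / p`_j).
Proof.
move=> [hV val] p0.
suff h n : (forall i, (i < n)%N -> p`_i = 0) \/
    exists2 j, p`_j != 0 & forall i, (i < n)%N -> V (p`_i / p`_j).
  have [pz|[j pj hj]] := h (size p).
    have := p0; rewrite -lead_coef_eq0 lead_coefE pz ?eqxx //.
    by rewrite ltn_predL lt0n size_poly_eq0.
  exists j => // i; have [/hj//|si] := ltnP i (size p).
  by rewrite nth_default // mul0r; apply: subring0.
elim: n => [|n IH]; first by left.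
have [pn|pn] := eqVneq p`_n 0.
  case: IH => [pz|[j pj hj]]; [left|right; exists j => //] => i; rewrite ltnS leq_eqVlt.
    by move=> /orP[/eqP-> //|/pz].
  by move=> /orP[/eqP->|/hj //]; rewrite pn mul0r; apply: subring0.
right; case: IH => [pz|[j pj hj]].
  exists n => // i; rewrite ltnS leq_eqVlt => /orP[/eqP->|/pz->].
    by rewrite divff //; apply: subring1.
  by rewrite mul0r; apply: subring0.
have [Vr|Vr] := val (p`_n / p`_j) (mulf_neq0 pn (invr_neq0 pj)).
  by exists j => // i; rewrite ltnS leq_eqVlt => /orP[/eqP->|/hj].
exists n => // i; rewrite ltnS leq_eqVlt => /orP[/eqP->|/hj hi].
  by rewrite divff //; apply: subring1.
suff -> : p`_i / p`_n = p`_i / p`_j * (p`_n / p`_j)^-1 by apply: subringM.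
by field; rewrite pn pj.
Qed.

(* In [K(X)] take valuation rings [W2 <= W1 <= W0] over the chain            *)
(* [Q <= N[X] < (N, X)].  Algebraicity gives [W1] and [W2] the same trace    *)
(* [V] on [K], so that a polynomial over [V] with some coefficient [1] is a  *)
(* unit of [W1]: membership in [Q] is decided by the content.                *)
Lemma alg_at_extended T N (Q : set {poly K}) : subring T -> prime_ideal T N ->
  alg_at T N -> prime_ideal (polyset T) Q -> Q `<=` polyset N ->
  Q = polyset [set a | T a /\ Q a%:P].
Proof.
move=> hT hN alg hQ QN.
have T0 := subring0 hT; have hNm := prime_submod hN; have N0 := submod0 hNm.
have hTX := polyset_subring hT; have hQm := prime_submod hQ.
have E0 : [set a | T a /\ Q a%:P] 0 by split=> //; exact: submod0 hQm.
rewrite eqEsubset; split=> f; last first.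
  move=> /(polyset_coef _ E0) fc; rewrite -[f]coefK poly_def.
  apply: (submod_sum _ hQm) => i; rewrite -mul_polyC.
  have [_ Qi] := fc i; apply: (submodMr hQm) => //.
  elim: (i : nat) => [|n IH]; first by rewrite expr0; apply: subring1.
  by rewrite exprS; apply: subringM => //; apply: polysetX.
move=> Qf; have [->|f0] := eqVneq f 0; first by apply/polyset_coef => // i; rewrite coef0.
pose L : fieldType := {fraction {poly K}}.
pose psi : {rmorphism {poly K} -> L} := @tofrac _.
pose phi : {rmorphism K -> L} := psi \o polyC.
have inj_psi : injective psi by move=> x y /eqP; rewrite tofrac_eq => /eqP.
have psiE p : psi p = (map_poly phi p).[psi 'X].
  by rewrite -[in LHS](comp_polyXr p) /comp_poly -horner_map -map_poly_comp.
(* The prime (N, X) of T[X]. *)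
pose NX := [set p | polyset T p /\ N p`_0].
have hNX : prime_ideal (polyset T) NX.
  apply: prime_idealP => //.
  - split; first by split; [exact: subring0|rewrite coef0].
      by move=> p q [Tp Np] [Tq Nq]; split; [exact: subringD|rewrite coefD; exact: (submodD hNm)].
    move=> p q Tp [Tq Nq]; split; [exact: subringM|rewrite coef0M; apply: (submodM hNm)] => //.
    by move/polyset_coef: Tp; apply.
  - by move=> p [].
  - by move=> []; rewrite coef1 => _; apply: prime_proper hN.
  - move=> p q Tp Tq []; rewrite coef0M => _.
    move/(prime_mulP hN (proj1 (polyset_coef _ T0) Tp _) (proj1 (polyset_coef _ T0) Tq _)).
    by case; [left|right].
pose A := psi @` polyset T.
have hA : subring A by apply: subring_image.
have hNT := polyset_prime hT hN.
have [W0 [hW0 AW0 W0A]] := valuation_exists hA (prime_image inj_psi hTX hQ).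
have QN' : psi @` Q `<=` psi @` polyset N by move=> _ [p /QN Np <-]; exists p.
have [W1 [hW1 AW1 W10 W01 W1A]] :=
  valuation_refine hA (prime_image inj_psi hTX hNT) QN' hW0 AW0 W0A.
have NNX : psi @` polyset N `<=` psi @` NX.
  move=> _ [p Np <-]; exists p => //; split; first exact: (prime_sub hNT).
  by move/polyset_coef: Np; apply.
have [W2 [hW2 AW2 W21 W12 W2A]] :=
  valuation_refine hA (prime_image inj_psi hTX hNX) NNX hW1 AW1 W1A.
have [hR0 _] := hW0; have [hR2 val2] := hW2.
have hm0 := prime_submod (max_ideal_prime hW0).
have hm1 := prime_refine hW1 hW2 W21 W12 (max_ideal_prime hW1).
have hm2 := max_ideal_prime hW2.
have TA p : polyset T p -> A (psi p) by exists p.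
have in_m (W : set L) (I : set {poly K}) p : max_ideal W `&` A = psi @` I ->
    polyset T p -> max_ideal W (psi p) -> I p.
  move=> WA Tp mp; have : (max_ideal W `&` A) (psi p) by split=> //; apply: TA.
  by rewrite WA => -[q Iq /inj_psi <-].
have out_m (W : set L) (I : set {poly K}) p : max_ideal W `&` A = psi @` I ->
    I p -> max_ideal W (psi p).
  move=> WA Ip; suff [] : (max_ideal W `&` A) (psi p) by [].
  by rewrite WA; exists p.
have TC a : T a -> polyset T a%:P by move=> Ta; apply/polysetC.
pose V := phi @^-1` W2.
have hV : subring V by apply: subring_preimage.
have TV : T `<=` V by move=> a Ta; apply: AW2; apply: TA; apply: TC.
(* On [K], the maximal ideals of [W1] and [W2] induce primes of [V] that both meet [T] in [N];
   incomparability makes them equal. *)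
have p21 a : max_ideal W2 (phi a) -> max_ideal W1 (phi a).
  move: a; apply: (alg_at_incomparable hT hV TV N0 alg (prime_preimage phi hR2 hm1)
    (prime_preimage phi hR2 hm2)).
  - by move=> a; apply: W12.
  - move=> a [/= ma Ta]; have /polysetC : polyset N a%:P by apply: (in_m W1 _ _ W1A) => //; exact: TC.
    by apply.
  - move=> a [/= ma Ta]; have [_ Na] : NX a%:P by apply: (in_m W2 _ _ W2A) => //; exact: TC.
    by apply: (out_m _ _ _ W1A); apply/polysetC => //; move: Na; rewrite coefC.
have X2 : max_ideal W2 (psi 'X).
  by apply: (out_m _ _ _ W2A); split; [exact: polysetX|rewrite coefX].
have X1 : ~ max_ideal W1 (psi 'X).
  move/(in_m _ _ _ W1A (polysetX hT)) => /(polyset_coef _ N0)/(_ 1%N).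
  by rewrite coefX; apply: prime_proper hN.
have coefs := coefs_in_prime hV hR2 hm1 hm2 W12 X2 X1 (fun a Va => Va) (fun a _ => p21 a).
have hv : valuation_ring V.
  by split=> // x x0; have := val2 (phi x); rewrite fmorph_eq0 -fmorphV; apply.
have [j fj Vf] := valuation_max_coef hv f0.
have Tf i : T f`_i by have /(polyset_coef _ T0) := prime_sub hQ Qf; apply.
(* Dividing by the coefficient of least value gives a polynomial over [V] with a coefficient equal
   to 1; by [coefs] its image cannot lie in the maximal ideal of [W1]. *)
pose g := (f`_j)^-1%:P * f.
have Vg : polyset V g.
  by apply/polyset_coef => [|i]; [exact: subring0|rewrite coefCM mulrC].
have ng : ~ max_ideal W1 (psi g).
  rewrite psiE => /(coefs _ Vg)/(_ j); rewrite coefCM mulVf // rmorph1.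
  exact: prime_proper hm1.
have Wg : W2 (psi g).
  rewrite psiE; apply: (@horner_submod _ W2) => //; first exact: subring_submodule.
    exact: (prime_sub hm2).
  apply/polyset_coef => [|i]; first exact: subring0.
  by rewrite coef_map; move/polyset_coef: Vg; apply; exact: subring0.
(* Since f = f_j g lies in [Q] and [g] is outside the maximal ideal of [W0], the factor f_j falls
   into that ideal, and with it all the other coefficients, being multiples of f_j over [V]. *)
have mfj : max_ideal W0 (phi f`_j).
  have : max_ideal W0 (phi f`_j * psi g).
    rewrite /phi /= -rmorphM /g mulrA -polyCM divff // mul1r.
    exact: (out_m _ _ _ W0A).
  case/(prime_mulP (max_ideal_prime hW0)) => // [||/W01//].
    by apply: AW0; apply: TA; apply: TC.
  by apply: W10; apply: W21.
apply/polyset_coef => // i; split=> //; apply: (in_m _ _ _ W0A); first exact: TC.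
have -> : psi (f`_i)%:P = phi (f`_i / f`_j) * phi f`_j by rewrite -rmorphM divfK.
by apply: (submodM hm0) => //; apply: W10; apply: W21; apply: Vf.
Qed.

(* If every polynomial killing [t] had its coefficients in [M], then the     *)
(* kernel of [X |-> t] would be extended from a nonzero ideal contracting to *)
(* [0].                                                                      *)
Lemma extended_alg_at D M : subring D -> has_quotient_field D -> M 0 ->
  (forall Q, prime_ideal (polyset D) Q -> Q `<=` polyset M ->
    Q = polyset [set a | D a /\ Q a%:P]) -> alg_at D M.
Proof.
move=> hD hK M0 ext t; apply: contrapT => noroot.
pose Q := [set p | polyset D p /\ p.[t] = 0].
have D0 := subring0 hD; have hDX := polyset_subring hD.
have hQ : prime_ideal (polyset D) Q.
  apply: prime_idealP => //.
  - split; first by split; [exact: subring0|rewrite horner0].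
      by move=> p q [Dp pt] [Dq qt]; split; [exact: subringD|rewrite hornerD pt qt addr0].
    by move=> p q Dp [Dq qt]; split; [exact: subringM|rewrite hornerM qt mulr0].
  - by move=> p [].
  - by move=> [_]; rewrite hornerC; apply/eqP/oner_neq0.
  - move=> p q Dp Dq [_]; rewrite hornerM => /eqP; rewrite mulf_eq0.
    by case/orP=> /eqP; [left|right].
have QM : Q `<=` polyset M.
  by move=> f [Df ft]; apply: contrapT => Mf; apply: noroot; exists f.
(* With t = a / b, the polynomial b X - a kills [t]; were [Q] extended, the nonzero constant [b]
   would lie in it. *)
have [a [b [Da Db b0 tE]]] := hK t.
have : Q (b%:P * 'X - a%:P).
  split; last by rewrite !hornerE tE mulrC divfK ?subrr.
  by apply: subringB => //; [apply: subringM => //; [|exact: polysetX]|]; apply/polysetC.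
rewrite (ext Q) // => /polyset_coef.
have E0 : [set a | D a /\ Q a%:P] 0 by split=> //; exact: submod0 (prime_submod hQ).
move/(_ E0)/(_ 1%N) => [_ [_]].
by rewrite coefB coefMX !coefC subr0 hornerC => /eqP; apply/negP.
Qed.

End AlgebraicAt.

(** * Semistar operations *)

Section Modules.
Variable K : fieldType.
Implicit Types (D T E F G I M P V : set K).

Lemma nonzero_elt D E : submodule D E -> E <> [set 0] -> exists2 x, E x & x != 0.
Proof.
move=> hE nE; apply: contrapT => h; apply: nE; rewrite eqEsubset; split=> x.
  by move=> Ex; apply/eqP; apply: contrapT => /negP x0; apply: h; exists x.
by move=> ->; apply: submod0 hE.
Qed.

Lemma nonzero_neq E (x : K) : E x -> x != 0 -> E <> [set 0].
Proof. by move=> Ex x0 E0; move: Ex; rewrite E0 => /= xz; rewrite xz eqxx in x0. Qed.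

Lemma subring_nz_submodule D : subring D -> nz_submodule D D.
Proof.
move=> hD; split; first exact: subring_submodule.
by apply: (@nonzero_neq _ 1); [exact: subring1|exact: oner_neq0].
Qed.

Lemma span_submodule D s : subring D -> submodule D (span D s).
Proof.
move=> hD; split.
- exists (fun=> 0); split=> [i|]; first exact: subring0.
  by rewrite big1 // => i _; rewrite mul0r.
- move=> _ _ [c [Dc ->]] [d [Dd ->]]; exists (fun i => c i + d i).
  split=> [i|]; first exact: subringD.
  by rewrite -big_split; apply: eq_bigr => i _; rewrite mulrDl.
- move=> a _ Da [c [Dc ->]]; exists (fun i => a * c i).
  split=> [i|]; first exact: subringM.
  by rewrite mulr_sumr; apply: eq_bigr => i _; rewrite mulrA.
Qed.

Lemma span_mem D s x : subring D -> x \in s -> span D s x.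
Proof.
move=> hD xs; exists (fun i => (i == index x s)%:R); split=> [i|].
  by case: (i == _); [exact: subring1|exact: subring0].
move: (xs); rewrite -index_mem => lt.
rewrite (bigD1 (Ordinal lt)) //= eqxx mul1r nth_index // big1 ?addr0 // => i.
by rewrite -val_eqE /= => /negPf ->; rewrite mul0r.
Qed.

Lemma span_min D E s : submodule D E -> (forall x, x \in s -> E x) -> span D s `<=` E.
Proof.
move=> hE sE _ [c [Dc ->]]; apply: (big_ind E) => [|x y|i _]; first exact: submod0 hE.
  exact: (submodD hE).
by apply: (submodM hE) => //; apply: sE; rewrite mem_nth.
Qed.

Lemma fg_span D s x : subring D -> x \in s -> x != 0 -> fg_submodule D (span D s).
Proof.
move=> hD xs x0; split; last by exists s.
split; first exact: span_submodule.
by apply: (nonzero_neq _ x0); apply: span_mem.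
Qed.

Lemma mulset_mem E F e f : E e -> F f -> mulset E F (e * f).
Proof.
move=> Ee Ff; exists [:: (e, f)]; split; last by rewrite big_seq1.
by move=> p; rewrite inE => /eqP ->.
Qed.

Lemma mulset_min E F G : G 0 -> (forall x y, G x -> G y -> G (x + y)) ->
  (forall e f, E e -> F f -> G (e * f)) -> mulset E F `<=` G.
Proof.
move=> G0 GD GM _ [s [hs ->]]; rewrite big_seq; apply: (big_ind G) => // p /hs[Ee Ff].
exact: GM.
Qed.

Lemma mulset_submodule T E F : submodule T F -> submodule T (mulset E F).
Proof.
move=> hF; split.
- by exists [::]; split=> //; rewrite big_nil.
- move=> _ _ [s [hs ->]] [t [ht ->]]; exists (s ++ t); rewrite big_cat; split=> // p.
  by rewrite mem_cat => /orP[/hs|/ht].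
- move=> a _ Ta [s [hs ->]]; exists [seq (p.1, a * p.2) | p <- s]; split=> [p|].
    by move=> /mapP[q /hs[Ee Ff] ->]; split=> //=; apply: (submodM hF).
  by rewrite big_map mulr_sumr; apply: eq_bigr => p _ /=; rewrite mulrCA.
Qed.

Lemma mulset_ring T E : subring T -> submodule T E -> mulset E T = E.
Proof.
move=> hT hE; rewrite eqEsubset; split; last first.
  by move=> x Ex; rewrite -[x]mulr1; apply: mulset_mem => //; apply: subring1.
apply: mulset_min; [exact: submod0 hE|by move=> x y; exact: (submodD hE)|].
by move=> e f Ee Tf; apply: (submodMr hE).
Qed.

Lemma mulset_span D T s : subring D -> subring T -> D `<=` T ->
  mulset (span D s) T = span T s.
Proof.
move=> hD hT DT; have hTs := span_submodule s hT.
rewrite eqEsubset; split.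
  apply: mulset_min; [exact: submod0 hTs|by move=> x y; exact: (submodD hTs)|].
  move=> e f se Tf; apply: (submodMr hTs) => //; move: e se; apply: span_min.
    exact: submoduleS hTs.
  by move=> x; apply: span_mem.
apply: span_min; first by apply: mulset_submodule; exact: subring_submodule.
move=> x xs; rewrite -[x]mulr1; apply: mulset_mem; [exact: span_mem|exact: subring1].
Qed.

Lemma mulset_fg D T F : subring D -> subring T -> D `<=` T -> fg_submodule D F ->
  fg_submodule T (mulset F T).
Proof.
move=> hD hT DT [[hF nF] [s FE]]; have [f Ff f0] := nonzero_elt hF nF.
split; last by exists s; rewrite FE; apply: mulset_span.
split; first by apply: mulset_submodule; exact: subring_submodule.
apply: (@nonzero_neq _ f) => //; rewrite -[f]mulr1; apply: mulset_mem => //.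
exact: subring1.
Qed.

Lemma prime_neq0 D P s : prime_ideal D P -> ~ P s -> s != 0.
Proof.
move=> hP Ps; apply/eqP => s0; apply: Ps; rewrite s0; exact: submod0 (prime_submod hP).
Qed.

(** The complement of [P] is multiplicative, so a finite sum of fractions has a common denominator
    outside [P]. *)
Lemma mulset_loc D P E x : subring D -> prime_ideal D P -> submodule D E ->
  mulset E (localization D P) x <-> exists e s, [/\ E e, D s, ~ P s & x = e / s].
Proof.
move=> hD hP hE; split; last first.
  move=> [e [s [Ee Ds Ps ->]]]; apply: mulset_mem => //.
  by exists 1, s; rewrite mul1r; split=> //; exact: subring1.
move: x; apply: mulset_min.
- exists 0, 1; rewrite mul0r; split=> //; [exact: submod0 hE|exact: subring1|].
  exact: prime_proper hP.
- move=> _ _ [e [s [Ee Ds Ps ->]]] [f [t [Ef Dt Pt ->]]].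
  exists (t * e + s * f), (s * t); split.
  + by apply: (submodD hE); apply: (submodM hE).
  + exact: subringM.
  + exact: prime_mulNP Ds Ps Dt Pt.
  + by field; rewrite (prime_neq0 hP Ps) (prime_neq0 hP Pt).
- move=> e _ Ee [a [s [Da Ds Ps ->]]]; exists (a * e), s; split=> //.
    exact: (submodM hE).
  by rewrite mulrCA mulrA.
Qed.

Lemma valuation_overringE D V :
  valuation_overring D V <-> valuation_ring V /\ D `<=` V.
Proof. by split=> [[[]]|[[]]]. Qed.

Lemma max_ideal_setT V : valuation_ring V -> max_ideal V `<=` [set 0] -> V = setT.
Proof.
move=> [hV _] h; rewrite eqEsubset; split=> // x _.
have [->|x0] := eqVneq x 0; first exact: subring0.
apply: contrapT => Vx; have : max_ideal V x^-1 by right; rewrite invrK.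
by move/h/eqP; rewrite invr_eq0; apply/negP.
Qed.

Lemma max_ideal_notT V : valuation_ring V -> V <> setT -> exists2 x, max_ideal V x & x != 0.
Proof.
move=> hV nV; apply: contrapT => h; apply: nV; apply: max_ideal_setT => // x mx.
by apply/eqP; apply: contrapT => /negP x0; apply: h; exists x.
Qed.

End Modules.

(** * Maximal quasi-ideals and the operation [star_tilde] *)

Section Tilde.
Variables (K : fieldType) (D : set K) (star : set K -> set K).
Hypotheses (hD : subring D) (hK : has_quotient_field D) (hstar : semistar D star).
Implicit Types (E F G I J M P V : set K).

Notation sf := (star_f D star).
Notation QM := (QMax D sf).
Notation tilde := (star_tilde D star).

Let D0 : D 0. Proof. exact: subring0. Qed.
Let D1 : D 1. Proof. exact: subring1. Qed.

Let star_mod E : nz_submodule D E -> nz_submodule D (star E).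
Proof. by have [h _ _ _] := hstar; apply: h. Qed.
Let star_submod E : nz_submodule D E -> submodule D (star E).
Proof. by move/star_mod=> []. Qed.
Let starS E F : nz_submodule D E -> nz_submodule D F -> E `<=` F -> star E `<=` star F.
Proof. by have [_ _ h _] := hstar; apply: h. Qed.
Let sub_star E : nz_submodule D E -> E `<=` star E.
Proof. by have [_ _ _ h] := hstar; move/h => []. Qed.
Let starK E : nz_submodule D E -> star (star E) = star E.
Proof. by have [_ _ _ h] := hstar; move/h => []. Qed.

Lemma fraction_mul (x : K) : x != 0 ->
  exists2 d, D d /\ d != 0 & D (d * x) /\ d * x != 0.
Proof.
move=> x0; have [a [b [Da Db b0 xE]]] := hK x; exists b => //.
by rewrite mulf_neq0 // xE mulrC divfK.
Qed.

(** The finitely generated submodules of [E] are directed: joining generating families yields one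
    witness for finitely many memberships in [star_f D star E]. *)
Lemma star_f_common E (s : seq K) : nz_submodule D E -> (forall x, x \in s -> sf E x) ->
  exists F, [/\ fg_submodule D F, F `<=` E & forall x, x \in s -> star F x].
Proof.
move=> [hE nE]; have [e Ee e0] := nonzero_elt hE nE; elim: s => [_|x s IH sE].
  exists (span D [:: e]); split=> //; first by apply: (fg_span hD _ e0); rewrite inE.
  by apply: span_min => // y; rewrite inE => /eqP ->.
have [F [hF FE Fs]] : exists F, [/\ fg_submodule D F, F `<=` E & forall x, x \in s -> star F x].
  by apply: IH => y ys; apply: sE; rewrite inE ys orbT.
have [G [hG GE] Gx] := sE x (mem_head _ _).
have [[hFm nF] [t1 Ft1]] := hF; have [[hGm nG] [t2 Gt2]] := hG.
have [f Ff f0] := nonzero_elt hFm nF.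
pose H := span D (f :: t1 ++ t2).
have fgH : fg_submodule D H by apply: (fg_span hD _ f0); rewrite inE eqxx.
have FH : F `<=` H.
  rewrite Ft1; apply: span_min; first by case: fgH => -[].
  by move=> y yt; apply: span_mem => //; rewrite inE mem_cat yt orbT.
have GH : G `<=` H.
  rewrite Gt2; apply: span_min; first by case: fgH => -[].
  by move=> y yt; apply: span_mem => //; rewrite inE mem_cat yt !orbT.
have [nzH _] := fgH.
exists H; split=> //.
  apply: span_min => // y; rewrite inE mem_cat => /orP[/eqP->|/orP[yt|yt]].
  - exact: FE.
  - by apply: FE; rewrite Ft1; apply: span_mem.
  - by apply: GE; rewrite Gt2; apply: span_mem.
move=> y; rewrite inE => /orP[/eqP->|/Fs]; first exact: (starS _ nzH GH).
exact: (starS _ nzH FH).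
Qed.

Lemma sub_star_f E : nz_submodule D E -> E `<=` sf E.
Proof.
move=> [hE nE] x Ex; have [e Ee e0] := nonzero_elt hE nE.
(* The generator [e] keeps the span nonzero when [x] is 0. *)
have fg : fg_submodule D (span D [:: x; e]).
  by apply: (fg_span hD _ e0); rewrite !inE eqxx orbT.
exists (span D [:: x; e]).
  split=> //; apply: span_min => // y; rewrite !inE => /orP[/eqP->|/eqP->] //.
apply: sub_star; first by case: fg.
by apply: span_mem => //; rewrite inE eqxx.
Qed.

Lemma star_f_submodule E : nz_submodule D E -> submodule D (sf E).
Proof.
move=> hE; split.
- by apply: sub_star_f => //; case: hE => /submod0.
- move=> x y xE yE; have [|F [hF FE Fs]] := @star_f_common E [:: x; y] hE.
    by move=> z; rewrite !inE => /orP[/eqP->|/eqP->].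
  have [nzF _] := hF; exists F => //; apply: (submodD (star_submod nzF)); apply: Fs.
    by rewrite inE eqxx.
  by rewrite !inE eqxx orbT.
- move=> a x Da [F [hF FE] Fx]; exists F => //; have [nzF _] := hF.
  exact: (submodM (star_submod nzF)).
Qed.

(** The generators of a finitely generated [F] inside [J] lie in a single [star G] with [G] inside
    [E], so [star F] is contained in [star (star G) = star G]. *)
Lemma star_f_idem E J : nz_submodule D E -> J `<=` sf E -> sf J `<=` sf E.
Proof.
move=> hE JE x [F [hF FJ] Fx]; have [nzF [s Fs]] := hF.
have [y ys|G [hG GE Gs]] := @star_f_common E s hE.
  by apply/JE/FJ; rewrite Fs; apply: span_mem.
have [nzG _] := hG; exists G => //; rewrite -(starK nzG).
apply: starS Fx => //; first exact: star_mod.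
by rewrite Fs; apply: span_min => //; apply: star_submod.
Qed.

Lemma nz_ideal_submodule I : nz_ideal D I -> nz_submodule D I.
Proof. by case=> -[]. Qed.

Lemma quasi_closure I : nz_ideal D I -> quasi_star_ideal D sf (sf I `&` D).
Proof.
move=> hI; have hIm := nz_ideal_submodule hI; have [[hIs ID] nI] := hI.
have IJ : I `<=` sf I `&` D by move=> x Ix; split; [exact: sub_star_f|exact: ID].
have hJ : nz_ideal D (sf I `&` D).
  split; first split.
  - apply: submoduleI; [exact: star_f_submodule|exact: subring_submodule].
  - by move=> x [].
  - by have [x Ix x0] := nonzero_elt hIs nI; apply: (nonzero_neq (IJ _ Ix)).
split=> //; rewrite eqEsubset; split=> [x [Jx Dx]|x Jx]; split=> //.
- by apply: (star_f_idem hIm) Jx => y [].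
- by apply: sub_star_f => //; apply: nz_ideal_submodule.
- by case: Jx.
Qed.

Lemma QMax_nz_ideal M : QM M -> nz_ideal D M. Proof. by case=> -[]. Qed.

Lemma QMax_proper M : QM M -> ~ sf M 1.
Proof.
move=> [[[hM _] ME] nM _] M1; apply: (ideal_proper hM nM).
by rewrite -ME.
Qed.

(** If [a * b] is in [M] but [a] is not, the closure of M + Da is a quasi-ideal strictly above [M],
    hence is [D]; so 1 lies in [star F] for some finitely generated [F] inside M + Da. Then bF lies
    in [M], and [b] lies in star (bF), hence in [M]. *)
Lemma QMax_prime M : QM M -> prime_ideal D M.
Proof.
move=> QMM; have [[[hM nzM] ME] nM Mmax] := QMM; have [hMm MD] := hM.
split=> // a b Da Db Mab; apply: contrapT => /not_orP[Ma Mb].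
have b0 : b != 0 by apply/eqP => b0; apply: Mb; rewrite b0; exact: submod0 hMm.
pose L := [set x | exists m d, [/\ M m, D d & x = m + d * a]].
have ML : M `<=` L by move=> m Mm; exists m, 0; rewrite mul0r addr0.
have La : L a by exists 0, 1; rewrite mul1r add0r; split=> //; exact: submod0 hMm.
have hL : nz_ideal D L.
  split; first split.
  - split; first exact/ML/(submod0 hMm).
      move=> _ _ [m [d [Mm Dd ->]]] [n [e [Mn De ->]]]; exists (m + n), (d + e).
      by split; [exact: (submodD hMm)|exact: subringD|ring].
    move=> c _ Dc [m [d [Mm Dd ->]]]; exists (c * m), (c * d).
    by split; [exact: (submodM hMm)|exact: subringM|ring].
  - move=> _ [m [d [Mm Dd ->]]]; apply: subringD => //; first exact: MD.
    exact: subringM.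
  - by have [x Mx x0] := nonzero_elt hMm nzM; apply: (nonzero_neq (ML _ Mx)).
have hJ := quasi_closure hL.
have LJ : L `<=` sf L `&` D.
  move=> x Lx; split; first by apply: sub_star_f => //; apply: nz_ideal_submodule.
  by case: hL => -[_ LD] _; apply: LD.
have [JD|nJ] := pselect (sf L `&` D = D); last first.
  by apply: Ma; rewrite -(Mmax _ hJ nJ (fun x Mx => LJ x (ML x Mx))); apply: LJ.
have [[F [hF FL] F1] _] : (sf L `&` D) 1 by rewrite JD.
have [[hFm nF] [s Fs]] := hF.
have [_ scale _ _] := hstar.
apply: Mb; rewrite -ME; split=> //; exists [set b * f | f in F].
  split; last first.
    move=> _ [f /FL[m [d [Mm Dd ->]]] <-].
    have -> : b * (m + d * a) = b * m + d * (a * b) by ring.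
    by apply: (submodD hMm); apply: (submodM hMm).
  have bF : [set b * f | f in F] = span D [seq b * x | x <- s].
    rewrite Fs eqEsubset; split.
      move=> _ [_ [c [Dc ->]] <-]; exists c; split=> //; rewrite size_map mulr_sumr.
      by apply: eq_bigr => i _; rewrite (nth_map 0) // mulrCA.
    move=> _ [c [Dc ->]]; exists (\sum_(i < size s) c i * s`_i); first by exists c.
    rewrite size_map mulr_sumr.
    by apply: eq_bigr => i _; rewrite (nth_map 0) // mulrCA.
  split; last by exists [seq b * x | x <- s].
  split; first by rewrite bF; apply: span_submodule.
  have [f Ff f0] := nonzero_elt hFm nF.
  by apply: (@nonzero_neq _ _ (b * f)); [exists f|rewrite mulf_neq0].
by rewrite scale //; exists 1 => //; rewrite mulr1.
Qed.

(** Zorn on the ideals whose [star_f]-closure misses 1. A maximal one equals the trace on [D] of its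
    closure, so it is a quasi-ideal. *)
Lemma QMax_above I : nz_ideal D I -> ~ sf I 1 -> exists2 M, QM M & I `<=` M.
Proof.
move=> hI nI; have [[hIm ID] nzI] := hI; have [e Ie e0] := nonzero_elt hIm nzI.
pose P J := ideal D J /\ ~ sf J 1.
have Pnz J : I `<=` J -> P J -> nz_ideal D J.
  by move=> IJ [hJ _]; split=> //; apply: (nonzero_neq (IJ _ Ie)).
have [F [X0 FX0] FP FI Ftot|M [PM IM Mmax]] := @Zorn_above K P I (conj hI.1 nI).
  have dir X Y : F X -> F Y -> exists Z, [/\ F Z, X `<=` Z & Y `<=` Z].
    by move=> FX FY; have [XY|YX] := Ftot _ _ FX FY; [exists Y|exists X]; split=> // ?.
  split.
    split; first split.
    - by exists X0 => //; have [[/submod0]] := FP _ FX0.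
    - move=> x y [X FX Xx] [Y FY Yy]; have [Z [FZ XZ YZ]] := dir _ _ FX FY.
      by exists Z => //; have [[hZ _] _] := FP _ FZ; apply: (submodD hZ); [exact: XZ|exact: YZ].
    - move=> a x Da [X FX Xx]; exists X => //; have [[hX _] _] := FP _ FX.
      exact: (submodM hX).
    - by move=> x [X FX Xx]; have [[_ XD] _] := FP _ FX; apply: XD.
  (* The generators of a finitely generated [G] all lie in one member of the chain, which would then
     have 1 in its closure. *)
  move=> [G [hG GU] G1]; have [_ [s Gs]] := hG.
  have [X FX sX] : exists2 X, F X & forall x, x \in s -> X x.
    have : forall x, x \in s -> (\bigcup_(X in F) X) x.
      by move=> x xs; apply: GU; rewrite Gs; apply: span_mem.
    elim: (s) => [|x t IH] hs; first by exists X0.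
    have [|X FX Xt] := IH; first by move=> y yt; apply: hs; rewrite inE yt orbT.
    have [Y FY Yx] := hs x (mem_head _ _); have [Z [FZ XZ YZ]] := dir _ _ FX FY.
    by exists Z => // y; rewrite inE => /orP[/eqP->|/Xt/XZ//]; apply: YZ.
  have [[hX _] nX] := FP _ FX; apply: nX; exists G => //; split=> //.
  by rewrite Gs; apply: span_min.
have hM := Pnz _ IM PM; have hMm := nz_ideal_submodule hM.
have hJ := quasi_closure hM.
have MJ : M `<=` sf M `&` D.
  by move=> x Mx; split; [exact: sub_star_f|case: hM => -[_ MD] _; apply: MD].
have JE : sf M `&` D = M.
  apply: Mmax MJ; split; first by case: hJ => -[].
  by move=> /(star_f_idem hMm) h; case: PM => _; apply; apply: h => x [].
exists M => //; split.
- by rewrite -[M]JE.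
- by move=> MD; case: PM => _; apply; apply: (sub_star_f hMm); rewrite MD.
- move=> J [hJz hJE] nJ MJ'; apply: Mmax => //; split; first by case: hJz.
  by move=> J1; apply: (ideal_proper hJz.1 nJ); rewrite -hJE.
Qed.

(** The local-to-finite step: an ideal that escapes every [M] already does so through a finitely
    generated submodule with 1 in its closure. *)
Lemma not_sub_QMax I : nz_ideal D I -> (forall M, QM M -> ~ I `<=` M) ->
  exists F, [/\ fg_submodule D F, F `<=` I & star F 1].
Proof.
move=> hI IM; apply: contrapT => h.
have [|M QMM] := QMax_above hI; last exact: IM.
by move=> [F [hF FI] F1]; apply: h; exists F.
Qed.

Lemma star1_not_sub_QMax F M : fg_submodule D F -> star F 1 -> QM M -> ~ F `<=` M.
Proof. by move=> hF F1 QMM FM; apply: (QMax_proper QMM); exists F. Qed.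

Lemma tildeE E x : submodule D E -> tilde E x <->
  forall M, QM M -> exists e s, [/\ E e, D s, ~ M s & x = e / s].
Proof.
move=> hE; split=> h M QMM; have := h M QMM.
  by move/mulset_loc; apply=> //; apply: QMax_prime.
by move=> h'; apply/mulset_loc => //; apply: QMax_prime.
Qed.

Lemma tilde1 E : submodule D E -> (forall M, QM M -> exists s, [/\ E s, D s & ~ M s]) ->
  tilde E 1.
Proof.
move=> hE h; apply/tildeE => // M QMM; have [s [Es Ds Ms]] := h M QMM.
by exists s, s; rewrite divff // (prime_neq0 (QMax_prime QMM) Ms).
Qed.

(** If [P] escapes every [M], each localization of [P] contains 1, and so does its closure. If [P]
    lies in [M], contracting P D_M to [D] returns [P]. *)
Lemma QSpec_tilde P : QSpec D tilde P <->
  [/\ prime_ideal D P, P <> [set 0] & exists2 M, QM M & P `<=` M].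
Proof.
split=> [[hP [[hI nP] PE]]|[hP nP [M QMM PM]]].
  split=> //; apply: contrapT => h; apply: (prime_proper hP); rewrite -PE; split=> //.
  apply: tilde1; first by case: hI.
  move=> M QMM; apply: contrapT => h'; apply: h; exists M => // s Ps.
  apply: contrapT => Ms; apply: h'; exists s; split=> //; exact: (prime_sub hP).
have hPm := prime_submod hP.
split=> //; split; first by split=> //; case: hP.
rewrite eqEsubset; split=> x; last first.
  move=> Px; split; last exact: (prime_sub hP).
  apply/tildeE => // N QN; exists x, 1; rewrite divr1; split=> //.
  exact: prime_proper (QMax_prime QN).
move=> [/(tildeE _ hPm)/(_ M QMM) [e [s [Pe Ds Ms xE]]] Dx].
have : P (x * s) by rewrite xE divfK // (prime_neq0 (QMax_prime QMM) Ms).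
by case/(prime_mulP hP Dx Ds) => // /PM.
Qed.

Lemma QMax_QSpec_tilde M : QM M -> QSpec D tilde M.
Proof.
move=> QMM; apply/QSpec_tilde; split; [exact: QMax_prime| |by exists M].
by have [] := QMax_nz_ideal QMM.
Qed.

(** Elements of [D] outside [M] are units of [V], so F D_M is contained in F V; for V = K it
    suffices that [F] is nonzero. *)
Lemma tilde_valuation V : valuation_ring V -> D `<=` V ->
  (V = setT \/ exists2 M, QM M & max_ideal V `&` D `<=` M) ->
  star_valuation_overring D tilde V.
Proof.
move=> hV DV h; split; first exact/valuation_overringE.
move=> F [[hF nF] _] x; case: h => [-> _|[M QMM mM]].
  have [f Ff f0] := nonzero_elt hF nF; rewrite -(divfK f0 x) mulrC.
  exact: mulset_mem.
move=> /(tildeE _ hF)/(_ M QMM) [e [s [Fe Ds Ms ->]]]; apply: mulset_mem => //.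
apply: contrapT => Vs; apply/Ms/mM; split=> //; by right.
Qed.

(** Otherwise some finitely generated [F] inside the centre has 1 in its closure, and the valuation
    condition puts 1 in F V, hence in the maximal ideal of [V]. The centre is nonzero because [V] is
    not [K]. *)
Lemma tilde_valuation_center V : star_valuation_overring D tilde V -> V <> setT ->
  exists2 M, QM M & max_ideal V `&` D `<=` M.
Proof.
move=> [/valuation_overringE[hV DV] val] nV; apply: contrapT => h.
have hm := max_ideal_prime hV; have mV := prime_sub hm.
have hP : prime_ideal D (max_ideal V `&` D) by apply: prime_contract hm.
have hI : nz_ideal D (max_ideal V `&` D).
  split; first by case: hP.
  have [x mx x0] := max_ideal_notT hV nV.
  have [d [Dd d0] [Ddx dx0]] := fraction_mul x0.
  apply: (@nonzero_neq _ _ (d * x)) => //; split=> //.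
  by apply: (submodM (prime_submod hm)) => //; apply: DV.
have [M QMM mM|F [hF Fm F1]] := not_sub_QMax hI.
  by apply: h; exists M.
have tF1 : tilde F 1.
  have [[hFm _] _] := hF; apply: tilde1 => // M QMM; apply: contrapT => h'.
  apply: (star1_not_sub_QMax hF F1 QMM) => s Fs; apply: contrapT => Ms.
  by apply: h'; exists s; split=> //; have [] := Fm _ Fs.
apply: (prime_proper hm); move: (val F hF 1 tF1); apply: mulset_min.
- by left.
- by move=> x y; apply: (submodD (prime_submod hm)).
- by move=> e f /Fm[me _] Vf; apply: (submodMr (prime_submod hm)).
Qed.

(** Each [M] is itself a quasi-prime of the tilde operation and every quasi-prime lies in some [M],
    so the condition only concerns primes inside M[X]. *)
Lemma quasi_prufer_tilde : quasi_prufer D tilde <-> forall M, QM M -> alg_at D M.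
Proof.
split=> [qp M QMM|alg Q hQ [P /QSpec_tilde[hP nP [M QMM PM]] QP]].
  have hM := QMax_prime QMM; apply: extended_alg_at => //.
    exact: submod0 (prime_submod hM).
  by move=> Q hQ QM'; apply: qp => //; exists M => //; apply: QMax_QSpec_tilde.
apply: (alg_at_extended hD (QMax_prime QMM) (alg _ QMM) hQ).
move=> p /QP; apply: polyset_sub => //; exact: submod0 (prime_submod hP).
Qed.

End Tilde.

(** If [N] met [D] in an ideal contained in no [M], a finitely generated [F] inside that ideal would
    satisfy [star F = star D]; linkedness then puts 1 in the closure of FT, a finitely generated
    submodule of [N], so [N] would not be proper. *)
Lemma linked_center (K : fieldType) (D T : set K) (star star' : set K -> set K) N :
  subring D -> has_quotient_field D -> semistar D star -> overring D T ->
  semistar T star' -> linked D star T star' -> QMax T (star_f T star') N ->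
  exists2 M, QMax D (star_f D star) M & N `&` D `<=` M.
Proof.
move=> hD hK hstar [hT DT] hstar' lnk QN; apply: contrapT => h.
have hN := QMax_prime hT hstar' QN; have [_ nzN] := QMax_nz_ideal QN.
have hND := prime_contract hD DT hN; have hNm := prime_submod hN.
have hI : nz_ideal D (N `&` D).
  split; first by case: hND.
  have [x Nx x0] := nonzero_elt hNm nzN.
  have [d [Dd d0] [Ddx dx0]] := fraction_mul hK x0.
  apply: (@nonzero_neq _ _ (d * x)) => //; split=> //.
  by apply: (submodM hNm) => //; apply: DT.
have [M QMM mM|F [hF FN F1]] := not_sub_QMax hD hstar hI; first by apply: h; exists M.
have [nzF _] := hF; have FD : F `<=` D by move=> x /FN[].
have nzD := subring_nz_submodule hD.
have [hmod _ hS hcl] := hstar.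
have FE : star F = star D.
  rewrite eqEsubset; split; first exact: hS.
  have [hsF _] := hmod _ nzF; have [_ <-] := hcl _ nzF; apply: hS => //.
    exact: hmod.
  by move=> d Dd; rewrite -[d]mulr1; apply: (submodM hsF).
have fgFT := mulset_fg hD hT DT hF.
apply: (QMax_proper hT QN); exists (mulset F T).
  split=> //; apply: mulset_min; first exact: submod0 hNm.
    by move=> x y; apply: (submodD hNm).
  by move=> e f /FN[Ne _] Tf; apply: (submodMr hNm).
rewrite (lnk F hF FD FE); have [_ _ _ hcl'] := hstar'.
have [h' _] := hcl' T (subring_nz_submodule hT).
by apply: h'; apply: subring1.
Qed.

(** * Dimensions *)

Section Supremum.
Implicit Types (S : set nat) (m n : nat).

(** The common shape, by conversion, of [krull_dim] and [star_dim]. *)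
Definition nat_sup S : \bar int := supremum 0%:E [set n%:Z%:E | n in S].

Lemma nat_supE S (x : \bar int) : S 0%N -> supremums [set n%:Z%:E | n in S] x ->
  nat_sup S = x.
Proof.
move=> S0 Sx; rewrite /nat_sup /supremum ifF; last first.
  by apply/negbTE/set0P; exists 0%:Z%:E; exists 0%N.
by rewrite (xget_subset1 _ Sx) //; apply: is_subset1_supremums.
Qed.

Lemma nat_sup_max S n : S 0%N -> S n -> (forall m, S m -> (m <= n)%N) ->
  nat_sup S = n%:Z%:E.
Proof.
move=> S0 Sn Smax; apply: nat_supE => //; split.
  by move=> _ [m /Smax mn <-]; rewrite lee_fin lez_nat.
by move=> y; apply; exists n.
Qed.

Lemma nat_sup_unbounded S : S 0%N -> (forall n, exists2 m, S m & (n < m)%N) ->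
  nat_sup S = +oo%E.
Proof.
move=> S0 Sinf; apply: nat_supE => //; split; first by move=> _ [m _ <-]; rewrite leey.
move=> [z||] ub //; last by have := ub _ (ex_intro2 _ _ 0%N S0 erefl).
have [m Sm zm] := Sinf `|z|%N.
have := ub _ (ex_intro2 _ _ m Sm erefl); rewrite lee_fin => mz.
by have := le_lt_trans mz (le_lt_trans (ler_norm z) _); rewrite -abszE => /(_ m%:Z zm); rewrite ltxx.
Qed.

Lemma bounded_nat_max S b : S 0%N -> (forall m, S m -> (m <= b)%N) ->
  exists n, S n /\ forall m, S m -> (m <= n)%N.
Proof.
move=> S0 Sb; have S0' : exists n, `[< S n >] by exists 0%N; apply/asboolP.
have Sb' n : `[< S n >] -> (n <= b)%N by move/asboolP/Sb.
case: (ex_maxnP S0' Sb') => n /asboolP Sn hn; exists n; split=> // m Sm.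
exact/hn/asboolP.
Qed.

Lemma nat_sup_le S n : S 0%N -> (forall m, S m -> (m <= n)%N) ->
  (nat_sup S <= n%:Z%:E)%E.
Proof.
move=> S0 Sn; have [k [Sk kS]] := bounded_nat_max S0 Sn.
by rewrite (nat_sup_max S0 Sk kS) lee_fin lez_nat; apply: Sn.
Qed.

Lemma nat_sup_cases S : S 0%N ->
  (exists n, S n /\ forall m, S m -> (m <= n)%N) \/ nat_sup S = +oo%E.
Proof.
move=> S0; have [[b Sb]|nb] := pselect (exists b, forall m, S m -> (m <= b)%N).
  by left; apply: bounded_nat_max Sb.
right; apply: nat_sup_unbounded => // n; apply: contrapT => h; apply: nb; exists n => m Sm.
by rewrite leqNgt; apply/negP => nm; apply: h; exists m.
Qed.

Lemma nat_sup_attained S : S 0%N -> (nat_sup S < +oo)%E ->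
  exists n, S n /\ forall m, S m -> (m <= n)%N.
Proof. by move=> S0; have [//|->] := nat_sup_cases S0; rewrite ltxx. Qed.

Lemma nat_sup_ge S n : S 0%N -> S n -> (n%:Z%:E <= nat_sup S)%E.
Proof.
move=> S0 Sn; have [[m [Sm mS]]|->] := nat_sup_cases S0; last by rewrite leey.
by rewrite (nat_sup_max S0 Sm mS) lee_fin lez_nat; apply: mS.
Qed.

End Supremum.

(** * Chains of primes and the Jaffard property *)

Section Chains.
Variable K : fieldType.
Implicit Types (A B D T V : set K) (star : set K -> set K) (P R : nat -> set K).

Definition prime_chain A (n : nat) : Prop := exists P,
  (forall i, (i <= n)%N -> prime_ideal A (P i)) /\ strict_chain P n.

Definition star_chain D star (n : nat) : Prop := exists P,
  [/\ P 0%N = [set 0], (forall i, (0 < i <= n)%N -> QSpec D star (P i))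
    & strict_chain P n].

Lemma star_dimE D star : star_dim D star = nat_sup (star_chain D star).
Proof. by []. Qed.

Lemma prime_zero A : subring A -> prime_ideal A [set 0].
Proof.
move=> hA; apply: prime_idealP => //.
- split=> [//|x y /= -> ->|a x _ /= ->]; first by rewrite addr0.
  by rewrite mulr0.
- by move=> x /= ->; apply: subring0.
- by move=> /= /eqP; apply/negP/oner_neq0.
- by move=> a b _ _ /= /eqP; rewrite mulf_eq0 => /orP[/eqP|/eqP]; [left|right].
Qed.

Lemma prime_chain0 A : subring A -> prime_chain A 0.
Proof. by move=> hA; exists (fun=> [set 0]); split=> // i _; apply: prime_zero. Qed.

Lemma star_chain0 D star : star_chain D star 0.
Proof. by exists (fun=> [set 0]); split=> // -[]. Qed.

Lemma strict_chain_le P n i j : strict_chain P n -> (i <= j <= n)%N -> P i `<=` P j.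
Proof.
move=> hP; elim: j => [|j IH]; first by rewrite leqn0 => /andP[/eqP -> _] x.
case/andP; rewrite leq_eqVlt => /orP[/eqP-> _ x //|]; rewrite ltnS => ij jn.
apply: (subset_trans (IH _)); first by rewrite ij ltnW.
by have [] := hP j jn.
Qed.

Lemma krull_dim_ge V n : subring V -> prime_chain V n -> (n%:Z%:E <= krull_dim V)%E.
Proof. by move=> hV; apply: nat_sup_ge; apply: prime_chain0. Qed.

Lemma krull_dim_le V n : subring V -> (forall m, prime_chain V m -> (m <= n)%N) ->
  (krull_dim V <= n%:Z%:E)%E.
Proof. by move=> hV; apply: nat_sup_le; apply: prime_chain0. Qed.

Lemma star_dim_vE D star n :
  (forall V, star_valuation_overring D star V -> (krull_dim V <= n%:Z%:E)%E) ->
  (exists2 V, star_valuation_overring D star V & krull_dim V = n%:Z%:E) ->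
  star_dim_v D star = n%:Z%:E.
Proof.
move=> ub [V hV VE]; apply: xget_unique.
  by exists n => //; split=> //; exists V.
move=> _ [m [ub' [W hW WE]] <-]; apply/eqP; rewrite eq_le.
by rewrite -{1}WE ub // -VE ub'.
Qed.

(** The default value of [xget] is infinite, so an integer value must satisfy the defining
    property. *)
Lemma star_dim_v_fin D star n : star_dim_v D star = n%:Z%:E ->
  forall V, star_valuation_overring D star V -> (krull_dim V <= n%:Z%:E)%E.
Proof.
by rewrite /star_dim_v; case: xgetP => [x _ [m [ub _] <-] <- //|].
Qed.

Lemma has_quotient_fieldS D T : D `<=` T -> has_quotient_field D -> has_quotient_field T.
Proof.
move=> DT hK x; have [a [b [Da Db b0 xE]]] := hK x.
by exists a, b; split=> //; apply: DT.
Qed.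

(** Incomparability provides, at each step of the chain, an element of [A] that is new, so the
    contractions stay distinct. *)
Lemma star_chain_contract A B star M n P : subring A -> subring B -> A `<=` B ->
  semistar A star -> QMax A (star_f A star) M -> alg_at A M ->
  (forall i, (i <= n)%N -> prime_ideal B (P i)) -> strict_chain P n ->
  P n `&` A `<=` M -> star_chain A (star_tilde A star) n.
Proof.
move=> hA hB AB hstar QMM alg hP hPs PnM.
have M0 : M 0 by have [[/submod0]] := QMax_nz_ideal QMM.
have PM i : (i <= n)%N -> P i `&` A `<=` M.
  by move=> lei a [Pa Aa]; apply: PnM; split=> //; apply: (strict_chain_le hPs) Pa; rewrite lei leqnn.
have new i : (i < n)%N -> exists a, [/\ P i.+1 a, A a & ~ P i a].
  move=> ltin; have [Pi nPi] := hPs i ltin; apply: contrapT => h; apply: nPi.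
  apply: (alg_at_incomparable hA hB AB M0 alg) => //.
  - by apply: hP; apply: ltnW.
  - exact: hP.
  - by apply: PM; apply: ltnW.
  - by move=> a [Pa Aa]; apply: contrapT => nPa; apply: h; exists a.
(* A chain of quasi-primes starts at (0), so the contraction of [P 0] is replaced by (0); the next
   contraction is nonzero, as it contains an element outside [P 0]. *)
exists (fun i => if i == 0%N then [set 0] else P i `&` A); split=> //.
  case=> // i /= lei; apply/QSpec_tilde => //; split.
  - exact: prime_contract (hP _ lei).
  - have [a [Pa Aa nPa]] := new i lei; apply: (@nonzero_neq _ _ a) => //.
    by apply: prime_neq0 nPa; apply: hP; apply: ltnW.
  - by exists M => //; apply: PM.
move=> i ltin; have [a [Pa Aa nPa]] := new i ltin; split=> /=.
  case: i ltin {Pa nPa} => [|i] ltin x /=.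
    by move=> ->; split; [exact: submod0 (prime_submod (hP _ ltin))|exact: subring0].
  by move=> [Px Ax]; split=> //; have [+ _] := hPs _ ltin; apply.
move/(_ a (conj Pa Aa)); case: eqP => [i0 /= a0|_ []//].
by apply: nPa; rewrite a0; apply: submod0 (prime_submod (hP _ (ltnW ltin))).
Qed.

Lemma prime_chain_rcons A P n (Q : set K) : (forall i, (i <= n)%N -> prime_ideal A (P i)) ->
  strict_chain P n -> prime_ideal A Q -> P n `<` Q -> prime_chain A n.+1.
Proof.
move=> hP Ps hQ PQ; exists (fun i => if (i <= n)%N then P i else Q).
split=> [i _|i]; first by case: ifP => // /hP.
rewrite ltnS => lei; have [->|ltin] : i = n \/ (i < n)%N.
- by move: lei; rewrite leq_eqVlt => /orP[/eqP|]; [left|right].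
- by rewrite /= leqnn ltnn.
- by rewrite /= ltin (ltnW ltin); apply: Ps.
Qed.

(** Each new prime of the chain refines the valuation ring [V] to [W]. The primes of [V] remain
    primes of [W], and [max_ideal W] is a further one because the centres differ. *)
Lemma valuation_over_chain T P n : subring T ->
  (forall i, (i <= n)%N -> prime_ideal T (P i)) -> strict_chain P n ->
  exists V, [/\ valuation_ring V, T `<=` V, max_ideal V `&` T = P n & prime_chain V n].
Proof.
move=> hT; elim: n => [|n IH] hP hPs.
  have [V [hV TV VP]] := valuation_exists hT (hP 0%N isT).
  exists V; split=> //; exists (fun=> max_ideal V); split=> // i _.
  exact: max_ideal_prime.
have [i lei|i ltin|V [hV TV VP [R [hR Rs]]]] := IH.
- by apply: hP; apply: leqW.
- by apply: hPs; apply: leqW.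
have [PS nPS] := hPs n (ltnSn n).
have [W [hW TW WV VW WP]] := valuation_refine hT (hP n.+1 (leqnn _)) PS hV TV VP.
exists W; split=> //; apply: (prime_chain_rcons (P := R) (Q := max_ideal W)) => //.
- by move=> i lei; apply: prime_refine hV hW WV VW _; apply: hR.
- exact: max_ideal_prime.
- have RV := prime_sub_max_ideal hV (hR n (leqnn n)).
  split=> [x /RV/VW //|WR]; apply: nPS; rewrite -VP -WP => x [/WR/RV mx Tx].
  by split.
Qed.

(** Chains of a valuation overring other than [K] contract into [A] below the [M] containing its
    centre, which bounds its dimension; a longest chain of quasi-primes lifts to a valuation
    overring that attains the bound. *)
Lemma jaffard_tilde A star : subring A -> has_quotient_field A -> semistar A star ->
  (forall M, QMax A (star_f A star) M -> alg_at A M) ->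
  (star_dim A (star_tilde A star) < +oo)%E -> jaffard A (star_tilde A star).
Proof.
move=> hA hK hstar alg fin; split=> //.
rewrite star_dimE in fin *; have c0 := star_chain0 A (star_tilde A star).
have [n [cn nmax]] := nat_sup_attained c0 fin.
rewrite (nat_sup_max c0 cn nmax); apply/esym.
have ub V : star_valuation_overring A (star_tilde A star) V -> (krull_dim V <= n%:Z%:E)%E.
  move=> sV; have [/valuation_overringE[hV AV] _] := sV; have [hVr _] := hV.
  apply: krull_dim_le => // m [R [hR Rs]].
  have [->//|m0] := posnP m.
  have nT : V <> setT.
    move=> VT; have [_] := Rs 0%N m0; apply=> x /(prime_sub_max_ideal hV (hR _ m0)).
    by case=> [->|]; [exact: submod0 (prime_submod (hR 0%N (leq0n m)))|rewrite VT => /(_ I)].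
  have [M QMM VM] := tilde_valuation_center hA hK hstar sV nT.
  apply: nmax; apply: (star_chain_contract hA hVr AV hstar QMM (alg _ QMM) hR Rs).
  by move=> a [Ra Aa]; apply: VM; split=> //; apply: prime_sub_max_ideal Ra => //; apply: hR.
apply: star_dim_vE => //; have [P [P0 PQ Ps]] := cn.
have hP i : (i <= n)%N -> prime_ideal A (P i).
  case: i => [|i] lei; first by rewrite P0; apply: prime_zero.
  by have [] := PQ i.+1 lei.
have [V [hV AV VP cV]] := valuation_over_chain hA hP Ps.
have sV : star_valuation_overring A (star_tilde A star) V.
  apply: tilde_valuation => //; case: n {c0 cn nmax ub Ps hP cV} PQ VP => [|n] PQ VP.
    (* In dimension 0 the lifted ring is centred on (0); clearing denominators, its maximal ideal is
       0 and it is [K]. *)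
    left; apply: max_ideal_setT => // x mx; apply/eqP; apply: contrapT => /negP x0.
    have [d [Ad d0] [Adx dx0]] := fraction_mul hK x0.
    suff : (max_ideal V `&` A) (d * x) by rewrite VP P0 => /= /eqP; apply/negP.
    by split=> //; apply: (submodM (prime_submod (max_ideal_prime hV))) => //; apply: AV.
  right; have /QSpec_tilde : QSpec A (star_tilde A star) (P n.+1) by apply: PQ; rewrite leqnn.
  by case=> // _ _ [M QMM PM]; exists M => //; rewrite VP.
exists V => //; apply/eqP; rewrite eq_le ub //= krull_dim_ge //.
by case: hV.
Qed.

Lemma star_dim_overring D T star star' : subring D -> has_quotient_field D ->
  semistar D star -> overring D T -> semistar T star' -> linked D star T star' ->
  (forall M, QMax D (star_f D star) M -> alg_at D M) ->
  (star_dim D (star_tilde D star) < +oo)%E -> (star_dim T (star_tilde T star') < +oo)%E.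
Proof.
move=> hD hK hstar oT hstar' lnk alg; have [hT DT] := oT.
rewrite !star_dimE => /(nat_sup_attained (star_chain0 _ _)) [n [_ nmax]].
apply: (le_lt_trans (nat_sup_le (n := n) (star_chain0 _ _) _)) => [m|]; last by rewrite ltry.
move=> [P [P0 PQ Ps]]; have [->//|m0] := posnP m.
have /QSpec_tilde : QSpec T (star_tilde T star') (P m) by apply: PQ; rewrite m0 leqnn.
case=> // _ _ [N QN PN].
have [M QMM NM] := linked_center hD hK hstar oT hstar' lnk QN.
apply: nmax; apply: (star_chain_contract hD hT DT hstar QMM (alg _ QMM) _ Ps).
  case=> [|i] lei; first by rewrite P0; apply: prime_zero.
  by have [] := PQ i.+1 lei.
by move=> a [Pa Da]; apply: NM; split=> //; apply: PN.
Qed.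

Lemma alg_at_linked D T star star' : subring D -> has_quotient_field D ->
  semistar D star -> overring D T -> semistar T star' -> linked D star T star' ->
  (forall M, QMax D (star_f D star) M -> alg_at D M) ->
  forall N, QMax T (star_f T star') N -> alg_at T N.
Proof.
move=> hD hK hstar oT hstar' lnk alg N QN; have [hT DT] := oT.
have [M QMM NM] := linked_center hD hK hstar oT hstar' lnk QN.
apply: (alg_atS _ _ _ DT NM (alg _ QMM)); first exact: subring0.
  by have [[/submod0]] := QMax_nz_ideal QMM.
by have [[/submod0]] := QMax_nz_ideal QN.
Qed.

End Chains.

(** * The tilde operation of [D] on an overring *)

Section TildeOverring.
Variables (K : fieldType) (D T : set K) (star : set K -> set K).
Hypotheses (hD : subring D) (hK : has_quotient_field D) (hstar : semistar D star).
Hypothesis (oT : overring D T).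
Implicit Types (E F I J M N P V : set K).

Notation QM := (QMax D (star_f D star)).
Notation tilde := (star_tilde D star).

Let hT : subring T. Proof. by case: oT. Qed.
Let DT : D `<=` T. Proof. by case: oT. Qed.
Let restrict E : submodule T E -> submodule D E. Proof. exact: submoduleS. Qed.
Let tE E x : submodule T E -> tilde E x <->
  forall M, QM M -> exists e s, [/\ E e, D s, ~ M s & x = e / s].
Proof. by move=> hE; apply: tildeE => //; apply: restrict. Qed.
Let mul_QM M s t : QM M -> D s -> ~ M s -> D t -> ~ M t -> ~ M (s * t).
Proof. by move=> /(QMax_prime hD hstar) hM; apply: prime_mulNP. Qed.
Let QM_neq0 M s : QM M -> ~ M s -> s != 0.
Proof. by move=> /(QMax_prime hD hstar) hM; apply: prime_neq0 hM. Qed.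
Let QM1 M : QM M -> ~ M 1.
Proof. by move=> /(QMax_prime hD hstar); apply: prime_proper. Qed.

Let sub_tilde E : submodule T E -> E `<=` tilde E.
Proof.
move=> hE x Ex; apply/tE => // M QMM; exists x, 1; rewrite divr1; split=> //.
  exact: subring1.
exact: QM1.
Qed.

Let tilde_submod E : submodule T E -> submodule T (tilde E).
Proof.
move=> hE; split; first exact/(sub_tilde hE)/(submod0 hE).
- move=> x y /(tE _ hE) hx /(tE _ hE) hy; apply/tE => // M QMM.
  have [e [s [Ee Ds Ms ->]]] := hx M QMM; have [f [t [Ef Dt Mt ->]]] := hy M QMM.
  exists (t * e + s * f), (s * t); split.
  + by apply: (submodD hE); apply: (submodM hE) => //; apply: DT.
  + exact: subringM.
  + exact: mul_QM.
  + by field; rewrite (QM_neq0 QMM Ms) (QM_neq0 QMM Mt).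
- move=> a x Ta /(tE _ hE) hx; apply/tE => // M QMM.
  have [e [s [Ee Ds Ms ->]]] := hx M QMM; exists (a * e), s; split=> //.
    exact: (submodM hE).
  by rewrite mulrA.
Qed.

Let tildeS E F : submodule T E -> submodule T F -> E `<=` F -> tilde E `<=` tilde F.
Proof.
move=> hE hF EF x /(tE _ hE) hx; apply/tE => // M QMM.
by have [e [s [/EF Fe Ds Ms ->]]] := hx M QMM; exists e, s.
Qed.

Let tilde_idem E : submodule T E -> tilde (tilde E) = tilde E.
Proof.
move=> hE; have htE := tilde_submod hE; rewrite eqEsubset; split; last exact: sub_tilde.
move=> x /(tE _ htE) hx; apply/tE => // M QMM.
have [e [s [/(tE _ hE) he Ds Ms ->]]] := hx M QMM.
have [f [t [Ef Dt Mt ->]]] := he M QMM.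
exists f, (t * s); split=> //; [exact: subringM|exact: mul_QM|].
by field; rewrite (QM_neq0 QMM Ms) (QM_neq0 QMM Mt).
Qed.

Lemma tilde_semistar : semistar T tilde.
Proof.
split.
- move=> E [hE nE]; split; first exact: tilde_submod.
  by have [e Ee e0] := nonzero_elt hE nE; apply: (nonzero_neq (sub_tilde hE Ee)).
- move=> x E x0 [hE _].
  have hxE : submodule T [set x * e | e in E].
    split; first by exists 0; [exact: submod0 hE|rewrite mulr0].
      by move=> _ _ [e Ee <-] [f Ef <-]; exists (e + f); [exact: (submodD hE)|rewrite mulrDr].
    by move=> a _ Ta [e Ee <-]; exists (a * e); [exact: (submodM hE)|rewrite mulrCA].
  rewrite eqEsubset; split.
    move=> y /(tE _ hxE) hy; exists (y / x); last by rewrite mulrC divfK.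
    apply/tE => // M QMM; have [_ [s [[e Ee <-] Ds Ms ->]]] := hy M QMM.
    by exists e, s; split=> //; field; rewrite x0 (QM_neq0 QMM Ms).
  move=> _ [y /(tE _ hE) hy <-]; apply/tE => // M QMM.
  have [e [s [Ee Ds Ms ->]]] := hy M QMM.
  by exists (x * e), s; rewrite mulrA; split=> //; exists e.
- by move=> E F [hE _] [hF _]; apply: tildeS.
- by move=> E [hE _]; split; [exact: sub_tilde|exact: tilde_idem].
Qed.

(** From [star F = star D] follows that 1 lies in [star F], so [F] has an element outside each [M],
    by which fractions over [T] can be expanded into fractions over FT. *)
Lemma tilde_linked : linked D star T tilde.
Proof.
move=> F hF FD FE; have hTT : submodule T T by exact: subring_submodule.
have [_ _ _ hcl] := hstar.
have F1 : star F 1.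
  rewrite FE; have [h _] := hcl D (subring_nz_submodule hD).
  by apply: h; apply: subring1.
have hFT : submodule T (mulset F T) by exact: mulset_submodule.
rewrite eqEsubset; split.
  apply: tildeS => //; apply: mulset_min; [exact: subring0|by move=> x y; exact: subringD|].
  by move=> f y /FD/DT; apply: subringM.
move=> x /(tE _ hTT) hx; apply/tE => // M QMM.
have [e [s [Te Ds Ms ->]]] := hx M QMM.
have [r [Fr Mr]] : exists r, F r /\ ~ M r.
  apply: contrapT => h; apply: (star1_not_sub_QMax hD hF F1 QMM) => r Fr.
  by apply: contrapT => Mr; apply: h; exists r.
exists (r * e), (r * s); split.
- exact: mulset_mem.
- by apply: subringM => //; apply: FD.
- by apply: mul_QM => //; apply: FD.
- by field; rewrite (QM_neq0 QMM Ms) (QM_neq0 QMM Mr).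
Qed.

(** An element [x] is in the closure of [E] exactly when its ideal of denominators lies in no
    maximal quasi-ideal. [not_sub_QMax] replaces this ideal by a finitely generated part, which can
    be compared between [D] and [T]. *)
Lemma tilde_tilde E : nz_submodule T E -> star_tilde T tilde E = tilde E.
Proof.
move=> [hE nE]; have [e Ee e0] := nonzero_elt hE nE.
have hsT := tilde_semistar.
(* The conductor of [x] into [E]; it is nonzero since e / x = c / d yields c x = d e in [E]. *)
have denominators A x : subring A -> D `<=` A -> A `<=` T -> x != 0 ->
    nz_ideal A [set d | A d /\ E (d * x)].
  move=> hA DA AT x0; split; first split.
  - split; first by split; [exact: subring0|rewrite mul0r; exact: submod0 hE].
      move=> c d [Ac Ec] [Ad Ed]; split; first exact: subringD.
      by rewrite mulrDl; apply: (submodD hE).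
    move=> c d Ac [Ad Ed]; split; first exact: subringM.
    by rewrite -mulrA; apply: (submodM hE) => //; apply: AT.
  - by move=> d [].
  - have [c [d [Dc Dd d0 cd]]] := hK (e / x).
    apply: (@nonzero_neq _ _ c).
      split; first exact: DA.
      have -> : c * x = d * e.
        by move/(congr1 (fun z => z * d * x)): cd; rewrite divfK // => <-; field.
      by apply: (submodM hE) => //; apply/DT.
    apply/eqP => c0; move/eqP: cd; rewrite c0 mul0r mulf_eq0 invr_eq0.
    by rewrite (negPf e0) (negPf x0).
rewrite eqEsubset; split=> x.
  have [-> _|x0] := eqVneq x 0; first exact/(sub_tilde hE)/(submod0 hE).
  move=> /(tildeE hT hsT _ hE) hx.
  have hJ := denominators T x hT DT (@subset_refl _ T) x0.
  have [|F [hF FJ F1]] := not_sub_QMax hT hsT hJ.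
    move=> N QN JN; have [f [s [Ef Ts Ns xE]]] := hx N QN.
    have s0 := prime_neq0 (QMax_prime hT hsT QN) Ns.
    by apply: Ns; apply: JN; split=> //; rewrite xE mulrC divfK.
  have [[hFm _] _] := hF; have [[hJm _] _] := hJ.
  move/(tildeS hFm hJm FJ)/(tE _ hJm): F1 => h1; apply/tE => // M QMM.
  have [d [s [[Td Ed] Ds Ms ds]]] := h1 M QMM.
  exists (d * x), s; split=> //.
  by rewrite mulrAC -ds mul1r.
have [-> _|x0] := eqVneq x 0.
  apply/(tildeE hT hsT) => // N QN.
  exists 0, 1; rewrite divr1; split=> //; [exact: submod0 hE|exact: subring1|].
  exact: (prime_proper (QMax_prime hT hsT QN)).
move=> /(tE _ hE) hx; apply/(tildeE hT hsT) => // N QN.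
have hI := denominators D x hD (@subset_refl _ D) DT x0.
have [|F [hF FI F1]] := not_sub_QMax hD hstar hI.
  move=> M QMM IM; have [f [s [Ef Ds Ms xE]]] := hx M QMM.
  have s0 := QM_neq0 QMM Ms.
  by apply: Ms; apply: IM; split=> //; rewrite xE mulrC divfK.
have hN := QMax_prime hT hsT QN; have hNm := prime_submod hN.
(* Were [F] inside [N], so would be FT; but [F] escapes every [M], hence 1 lies in the tilde closure
   of FT, and [N] would not be proper. *)
have [s [Fs Ns]] : exists s, F s /\ ~ N s.
  apply: contrapT => h; apply: (QMax_proper hT QN); exists (mulset F T).
    split; first exact: (mulset_fg hD hT DT hF).
    apply: mulset_min; [exact: submod0 hNm|by move=> y z; exact: (submodD hNm)|].
    move=> f y Ff Ty; apply: (submodMr hNm) => //.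
    by apply: contrapT => Nf; apply: h; exists f.
  apply/tE; first by apply: mulset_submodule; exact: subring_submodule.
  move=> M QMM; have [r [Fr Mr]] : exists r, F r /\ ~ M r.
    apply: contrapT => h'; apply: (star1_not_sub_QMax hD hF F1 QMM) => r Fr.
    by apply: contrapT => Mr; apply: h'; exists r.
  exists r, r; rewrite divff ?(QM_neq0 QMM Mr) //; split=> //; last by have [] := FI _ Fr.
  by rewrite -[r]mulr1; apply: mulset_mem => //; exact: subring1.
have [Ds Esx] := FI _ Fs.
exists (s * x), s; split=> //; first exact: DT.
by rewrite mulrC mulKf // (prime_neq0 hN Ns).
Qed.

End TildeOverring.

(** Operations are total maps that matter only on nonzero submodules; [tilde_tilde] gives agreement
    there and not equality of maps. *)
Lemma jaffard_ext (K : fieldType) (T : set K) (star1 star2 : set K -> set K) :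
  (forall E, nz_submodule T E -> star1 E = star2 E) -> jaffard T star1 -> jaffard T star2.
Proof.
move=> E12; rewrite /jaffard.
have QE : QSpec T star1 = QSpec T star2.
  rewrite eqEsubset; split=> P [hP [hI PE]]; (split=> //; split=> //); rewrite -[RHS]PE.
    by rewrite E12 //; apply: nz_ideal_submodule.
  by rewrite E12 //; apply: nz_ideal_submodule.
have VE : star_valuation_overring T star1 = star_valuation_overring T star2.
  rewrite eqEsubset; split=> V [hV h]; split=> // F hF; have [nzF _] := hF.
    by rewrite -E12 //; apply: h.
  by rewrite E12 //; apply: h.
by rewrite /star_dim /star_dim_v QE VE.
Qed.

(** * Two valuation rings over a transcendental residue *)

Section NotAlgebraic.
Variables (K : fieldType) (D M : set K) (t : K).
Hypotheses (hD : subring D) (hM : prime_ideal D M).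
Hypothesis bad : forall f, polyset D f -> f.[t] = 0 -> polyset M f.
Implicit Types (p q : {poly K}).

(** [A] is D[t], with the ideals Q = M D[t] and N = (M, t). By [bad], a polynomial is determined
    modulo M[X] by its value at [t], so D[t] / Q is a polynomial ring over D / M; hence both ideals
    are prime and lie over [M]. *)
Let A : set K := [set p.[t] | p in polyset D].
Let Q : set K := [set p.[t] | p in polyset M].
Let N : set K := [set p.[t] | p in [set p | polyset D p /\ M p`_0]].

Let hMm : submodule D M. Proof. exact: prime_submod. Qed.
Let D0 : D 0. Proof. exact: subring0. Qed.
Let M0 : M 0. Proof. exact: submod0 hMm. Qed.
Let MD : M `<=` D. Proof. exact: prime_sub. Qed.
Let hDX : subring (polyset D). Proof. exact: polyset_subring. Qed.
Let hMX : prime_ideal (polyset D) (polyset M). Proof. exact: polyset_prime. Qed.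
Let Dcoef p i : polyset D p -> D p`_i.
Proof. by move/(polyset_coef _ D0). Qed.

Let eval_eq p q : polyset D p -> polyset D q -> p.[t] = q.[t] -> polyset M (p - q).
Proof.
move=> Dp Dq pq; apply: bad; first exact: subringB.
by rewrite hornerD hornerN pq subrr.
Qed.

Let evalM p : polyset D p -> Q p.[t] -> polyset M p.
Proof.
move=> Dp [q Mq qp]; rewrite -[p](subrK q).
apply: (submodD (prime_submod hMX)) => //; apply: eval_eq => //.
exact: (prime_sub hMX).
Qed.

Let evalN p : polyset D p -> N p.[t] -> M p`_0.
Proof.
move=> Dp [q [Dq Mq] qp]; have /(polyset_coef _ M0)/(_ 0%N) := eval_eq Dp Dq (esym qp).
by rewrite coefB => h; rewrite -(subrK q`_0 p`_0); apply: (submodD hMm).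
Qed.

Let hA : subring A.
Proof.
apply/subringP; split.
- by exists 1; [exact: subring1|rewrite hornerC].
- by move=> _ _ [p Dp <-] [q Dq <-]; exists (p - q); [exact: subringB|rewrite !hornerE].
- by move=> _ _ [p Dp <-] [q Dq <-]; exists (p * q); [exact: subringM|rewrite hornerM].
Qed.

Let hQ : prime_ideal A Q.
Proof.
have hMXm := prime_submod hMX; apply: prime_idealP => //.
- split; first by exists 0; [exact: submod0 hMXm|rewrite horner0].
    by move=> _ _ [p Mp <-] [q Mq <-]; exists (p + q); [exact: (submodD hMXm)|rewrite hornerD].
  by move=> _ _ [p Dp <-] [q Mq <-]; exists (p * q); [exact: (submodM hMXm)|rewrite hornerM].
- by move=> _ [p Mp <-]; exists p => //; apply: (prime_sub hMX).
- move=> Q1; apply: (prime_proper hMX); apply: evalM; first exact: subring1.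
  by rewrite hornerC.
- move=> _ _ [p Dp <-] [q Dq <-]; rewrite -hornerM => /(evalM (subringM hDX Dp Dq)).
  by case/(prime_mulP hMX Dp Dq); [left; exists p|right; exists q].
Qed.

Let hN : prime_ideal A N.
Proof.
apply: prime_idealP => //.
- split; first by exists 0; [split; [exact: subring0|rewrite coef0]|rewrite horner0].
    move=> _ _ [p [Dp Mp] <-] [q [Dq Mq] <-]; exists (p + q); last by rewrite hornerD.
    by split; [exact: subringD|rewrite coefD; exact: (submodD hMm)].
  move=> _ _ [p Dp <-] [q [Dq Mq] <-]; exists (p * q); last by rewrite hornerM.
  by split; [exact: subringM|rewrite coef0M; apply: (submodM hMm) => //; exact: Dcoef].
- by move=> _ [p [Dp _] <-]; exists p.
- have := evalN (subring1 hDX); rewrite hornerC coefC => h N1.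
  exact: (prime_proper hM (h N1)).
- move=> _ _ [p Dp <-] [q Dq <-]; rewrite -hornerM => /(evalN (subringM hDX Dp Dq)).
  rewrite coef0M => /(prime_mulP hM (Dcoef _ Dp) (Dcoef _ Dq)).
  by case; [left; exists p|right; exists q].
Qed.

Lemma transcendental_valuations : exists V W, [/\
  [/\ valuation_ring V, D `<=` V, max_ideal V `&` D = M & ~ max_ideal V t],
  [/\ valuation_ring W, D `<=` W, max_ideal W `&` D = M & max_ideal W t]
  & W `<=` V /\ max_ideal V `<=` max_ideal W].
Proof.
have QN : Q `<=` N.
  move=> _ [p Mp <-]; exists p => //; split; first exact: (prime_sub hMX).
  by move/(polyset_coef _ M0): Mp; apply.
have [V [hV AV VQ]] := valuation_exists hA hQ.
have [W [hW AW WV VW WN]] := valuation_refine hA hN QN hV AV VQ.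
have DA : D `<=` A by move=> d Dd; exists d%:P; [exact/polysetC|rewrite hornerC].
have At : A t by exists 'X; [exact: polysetX|rewrite hornerX].
have trace U I : max_ideal U `&` A = I -> I `&` D = M -> max_ideal U `&` D = M.
  move=> UI IM; rewrite -IM -UI eqEsubset; split=> d; last by case=> [[]].
  by case=> md Dd; split=> //; split=> //; apply: DA.
exists V, W; split=> //; split=> //.
- by move=> d /DA/AV.
- apply: trace VQ _; rewrite eqEsubset; split=> d.
    move=> [Qd Dd]; have /polysetC : polyset M d%:P; last by apply.
    by apply: evalM; [exact/polysetC|rewrite hornerC].
  move=> Md; split; last exact: MD.
  by exists d%:P; [exact/polysetC|rewrite hornerC].
- move=> mt; have : Q 'X.[t] by rewrite -VQ hornerX.
  move/(evalM (polysetX hD))/(polyset_coef _ M0)/(_ 1%N).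
  by rewrite coefX; apply: prime_proper hM.
- by move=> d /DA/AW.
- apply: trace WN _; rewrite eqEsubset; split=> d.
    move=> [Nd Dd]; have := @evalN d%:P; rewrite hornerC coefC; apply=> //.
    exact/polysetC.
  move=> Md; split; last exact: MD.
  exists d%:P; last by rewrite hornerC.
  by split; [exact/polysetC/MD|rewrite coefC].
- suff [] : (max_ideal W `&` A) t by [].
  rewrite WN; exists 'X; last by rewrite hornerX.
  by split; [exact: polysetX|rewrite coefX].
Qed.

End NotAlgebraic.

(** * The primes of the ring [D_M + m_V] *)

Section Pullback.
Variables (K : fieldType) (D M V : set K).
Hypotheses (hD : subring D) (hM : prime_ideal D M).
Hypotheses (hV : valuation_ring V) (DV : D `<=` V) (VM : max_ideal V `&` D = M).

(* [D_M + m_V], the preimage in [V] of the residue field of [M] *)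
Definition pullback : set K :=
  [set x | exists e s m, [/\ D e, D s, ~ M s, max_ideal V m & x = e / s + m]].

Let hVr : subring V. Proof. by case: hV. Qed.
Let hm : submodule V (max_ideal V).
Proof. exact: prime_submod (max_ideal_prime hV). Qed.
Let mV : max_ideal V `<=` V. Proof. exact: max_ideal_sub. Qed.
Let s_neq0 s : ~ M s -> s != 0. Proof. exact: prime_neq0 hM. Qed.

Lemma inv_outside W s : valuation_ring W -> max_ideal W `&` D = M -> D s -> ~ M s -> W s^-1.
Proof.
move=> hW WM Ds Ms; apply: contrapT => Ws; apply: Ms; rewrite -WM; split=> //.
by right.
Qed.

Lemma sub_pullback : D `<=` pullback.
Proof.
move=> d Dd; exists d, 1, 0; rewrite divr1 addr0; split=> //.
- exact: subring1.
- exact: prime_proper hM.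
- exact: submod0 hm.
Qed.

Lemma max_ideal_sub_pullback : max_ideal V `<=` pullback.
Proof.
move=> m mm; exists 0, 1, m; rewrite mul0r add0r; split=> //.
- exact: subring0.
- exact: subring1.
- exact: prime_proper hM.
Qed.

Lemma pullback_sub W : valuation_ring W -> D `<=` W -> max_ideal W `&` D = M ->
  max_ideal V `<=` max_ideal W -> pullback `<=` W.
Proof.
move=> hW DW WM VW _ [e [s [m [De Ds Ms mm ->]]]]; have [hWr _] := hW.
apply: subringD => //; last exact/(max_ideal_sub hW)/VW.
by apply: subringM => //; [exact: DW|exact: inv_outside WM Ds Ms].
Qed.

Let pV : pullback `<=` V. Proof. exact: pullback_sub. Qed.

Lemma pullback_subring : subring pullback.
Proof.
apply/subringP; split; first exact: sub_pullback (subring1 hD).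
- move=> _ _ [e [s [m [De Ds Ms mm ->]]]] [f [u [n [Df Du Mu mn ->]]]].
  exists (e * u - f * s), (s * u), (m - n); split.
  + by apply: subringB => //; apply: subringM.
  + exact: subringM.
  + exact: prime_mulNP hM Ds Ms Du Mu.
  + exact: (submodB hVr hm).
  + by field; rewrite (s_neq0 Ms) (s_neq0 Mu).
- move=> _ _ [e [s [m [De Ds Ms mm ->]]]] [f [u [n [Df Du Mu mn ->]]]].
  exists (e * f), (s * u), (e / s * n + (f / u + n) * m); split.
  + exact: subringM.
  + exact: subringM.
  + exact: prime_mulNP hM Ds Ms Du Mu.
  + apply: (submodD hm); apply: (submodM hm) => //.
      by apply: pV; exists e, s, 0; rewrite addr0; split=> //; exact: submod0 hm.
    by apply: pV; exists f, u, n.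
  + by field; rewrite (s_neq0 Ms) (s_neq0 Mu).
Qed.

(** This makes the pullback local with maximal ideal m_V: if x = e / s + m is outside m_V, then [e]
    is outside [M], and s / e inverts [x] modulo m_V. *)
Lemma pullback_inv x : pullback x -> ~ max_ideal V x -> pullback x^-1.
Proof.
move=> px mx; have Vx : V x^-1 by apply: contrapT => Vx; apply: mx; right.
have x0 : x != 0 by apply/eqP => x0; apply: mx; left.
have [e [s [m [De Ds Ms mm xE]]]] := px.
have Me : ~ M e.
  rewrite -VM => -[me _]; apply: mx; rewrite xE; apply: (submodD hm) => //.
  by apply: (submodMr hm) => //; apply: inv_outside VM Ds Ms.
(* The last witness is the difference of [x^-1] and s / e, computed from x = e / s + m. *)
exists s, e, (- (x^-1 * (s / e * m))); split=> //.
  apply: (submodN hVr hm); apply: (submodM hm) => //; apply: (submodM hm) => //.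
  by apply: subringM => //; [exact: DV|exact: inv_outside VM De Me].
have -> : m = x - e / s by rewrite xE addrC addKr.
by field; rewrite x0 (s_neq0 Me) (s_neq0 Ms).
Qed.

(** Locality gives [P] inside m_V. If they differ, pick [y] in m_V outside [P]: multiplication by
    [y] sends [V] into m_V, hence into the pullback, where primality of [P] allows [y] to be
    cancelled. *)
Lemma prime_pullback P : prime_ideal pullback P -> prime_ideal V P.
Proof.
move=> hP; have hPm := prime_submod hP; have Pp := prime_sub hP.
have Pm : P `<=` max_ideal V.
  move=> x Px; apply: contrapT => mx; apply: (prime_proper hP).
  have x0 : x != 0 by apply/eqP => x0; apply: mx; left.
  rewrite -(mulVf x0); apply: (submodM hPm) => //.
  by apply: pullback_inv => //; apply: Pp.
have [mP|] := pselect (max_ideal V `<=` P).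
  suff -> : P = max_ideal V by apply: max_ideal_prime.
  by rewrite eqEsubset.
move=> /existsNP[y /not_implyP[my Py]]; have py := max_ideal_sub_pullback my.
have VP v x : V v -> P x -> P (v * x).
  move=> Vv Px; have : P (v * x * y).
    rewrite -mulrA mulrCA; apply: (submodMr hPm) => //.
    by apply: max_ideal_sub_pullback; apply: (submodM hm).
  have pvx : pullback (v * x) by apply: max_ideal_sub_pullback; apply: (submodM hm) => //; exact: Pm.
  by case/(prime_mulP hP pvx py).
apply: prime_idealP => //.
- by case: hPm => P0 PD _; split.
- by move=> x /Pm/mV.
- exact: prime_proper hP.
have Pdiv a : V a -> P (a * y) -> P a.
  move=> Va Pay; have [ma|ma] := pselect (max_ideal V a).
    by case/(prime_mulP hP (max_ideal_sub_pullback ma) py): Pay.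
  have a0 : a != 0 by apply/eqP => a0; apply: ma; left.
  case: Py; rewrite -(mulKf a0 y); apply: VP => //.
  by apply: contrapT => Va'; apply: ma; right.
move=> a b Va Vb Pab.
have pay : pullback (a * y) by apply: max_ideal_sub_pullback; apply: (submodM hm).
have pby : pullback (b * y) by apply: max_ideal_sub_pullback; apply: (submodM hm).
have : P (a * y * (b * y)).
  by rewrite mulrACA mulrC; apply: VP => //; apply: mV; apply: (submodM hm) => //; exact: mV.
by case/(prime_mulP hP pay pby) => /Pdiv h; [left|right]; apply: h.
Qed.

End Pullback.

(* [D_M + m_V] has the primes of [V], yet is dominated by the valuation ring *)
(* [W], which has one more.                                                  *)
Lemma jaffard_alg_at (K : fieldType) (D : set K) (star : set K -> set K) :
  subring D -> has_quotient_field D -> semistar D star ->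
  (forall T : set K, overring D T -> jaffard T (star_tilde D star)) ->
  forall M, QMax D (star_f D star) M -> alg_at D M.
Proof.
move=> hD hK hstar jaf M QMM; have hM := QMax_prime hD hstar QMM.
move=> t; apply: contrapT => noroot.
have bad f : polyset D f -> f.[t] = 0 -> polyset M f.
  by move=> Df ft; apply: contrapT => Mf; apply: noroot; exists f.
have [V [W [[hV DV VM Vt] [hW DW WM Wt] [WV VW]]]] := transcendental_valuations hD hM bad.
pose T := pullback D M V.
have hT : subring T by apply: pullback_subring.
have DT : D `<=` T by apply: sub_pullback.
have TW : T `<=` W by apply: pullback_sub.
have [fin dimE] := jaf T (conj hT DT).
have c0 := star_chain0 T (star_tilde D star).
have [n [[P [P0 PQ Ps]] nmax]] := nat_sup_attained c0 fin.
have hP i : (i <= n)%N -> prime_ideal V (P i).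
  move=> lei; apply: (prime_pullback hD hM hV DV VM).
  case: i lei => [|i] lei; first by rewrite P0; apply: prime_zero.
  by have [] := PQ i.+1 lei.
(* Elements of [D] outside [M] are units of [W], so F D_M is contained in F W. *)
have sW : star_valuation_overring T (star_tilde D star) W.
  split; first exact/valuation_overringE.
  move=> F [[hF _] _] x /(tildeE hD hstar _ (submoduleS DT hF))/(_ M QMM).
  move=> [e [s [Fe Ds Ms ->]]]; apply: mulset_mem => //.
  exact: inv_outside WM Ds Ms.
have [hWr _] := hW.
(* The extra prime is [max_ideal W]: it contains [t], while [P n] lies in [max_ideal V], which does
   not. *)
have : prime_chain W n.+1.
  apply: (prime_chain_rcons (P := P) (Q := max_ideal W)) => //.
  - by move=> i lei; apply: prime_refine hV hW WV VW _; apply: hP.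
  - exact: max_ideal_prime.
  - have PV := prime_sub_max_ideal hV (hP n (leqnn n)).
    by split=> [x /PV/VW //|/(_ t Wt)/PV].
move/(krull_dim_ge hWr) => gen1.
have len : (krull_dim W <= n%:Z%:E)%E.
  apply: star_dim_v_fin sW; rewrite -dimE; apply: nat_sup_max => //.
  by exists P.
by have := le_trans gen1 len; rewrite lee_fin lez_nat ltnn.
Qed.

Theorem theorem4p14 (K : fieldType) (D : set K) (star : set K -> set K)
    (hD : subring D) (hK : has_quotient_field D) (hstar : semistar D star)
    (hdim : (star_dim D (star_tilde D star) < +oo)%E) :
  [<-> quasi_prufer D (star_tilde D star);
       forall (T : set K) (star' : set K -> set K),
         overring D T -> semistar T star' -> linked D star T star' ->
         quasi_prufer T (star_tilde T star');
       forall (T : set K) (star' : set K -> set K),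
         overring D T -> semistar T star' -> linked D star T star' ->
         jaffard T (star_tilde T star');
       forall T : set K, overring D T ->
         jaffard T (star_iota (star_tilde D star))].
Proof.
split; last split; last split.
- move=> /(quasi_prufer_tilde hD hK hstar) alg T star' oT hstar' lnk.
  have [hT DT] := oT.
  apply/(quasi_prufer_tilde hT (has_quotient_fieldS DT hK) hstar').
  exact: alg_at_linked lnk alg.
- move=> qp T star' oT hstar' lnk; have [hT DT] := oT.
  (* [D] is linked to itself, so (2) at T = D gives back (1), from which both the algebraicity and
     the dimension bound for [T] follow. *)
  have lnkD : linked D star D star.
    by move=> F [[hF _] _] _ FE; rewrite mulset_ring.
  have /(quasi_prufer_tilde hD hK hstar) alg := qp D star (conj hD (@subset_refl _ D)) hstar lnkD.
  apply: jaffard_tilde => //; first exact: has_quotient_fieldS DT hK.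
    exact: alg_at_linked lnk alg.
  exact: star_dim_overring lnk alg hdim.
- move=> jaf T oT; apply: (jaffard_ext (star1 := star_tilde T (star_tilde D star))).
    by move=> E hE; apply: tilde_tilde hE.
  by apply: jaf => //; [exact: tilde_semistar|exact: tilde_linked].
- move=> jaf; apply/(quasi_prufer_tilde hD hK hstar).
  exact: jaffard_alg_at jaf.
Qed.
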